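(* Fix $\epsilon>0$. Then (1) $\displaystyle\lim_{g\to\infty}\mathbb{P}_{g}\left[\left|e(S)-\frac{1}{\sqrt{5}}\, g \right|< \epsilon g\right] = 1$, and (2) $\displaystyle\lim_{g\to\infty}\mathbb{P}_{g}\left[\left|t(S)-(1-\gamma) g \right|< \epsilon g\right] = 1$, where $\gamma=\frac{5+\sqrt{5}}{10}$.
   Context: A numerical semigroup $S$ is a submonoid of $\mathbb{N}_0$ with finite complement; $\mathcal{H}(S)=\mathbb{N}_0\setminus S$ is its set of gaps and $g(S)=|\mathcal{H}(S)|$ its genus. The embedding dimension $e(S)$ is the number of elements of the minimal generating set $(S\setminus\{0\})\setminus((S\setminus\{0\})+(S\setminus\{0\}))$. The pseudo-Frobenius numbers are $PF(S)=\{P\in\mathcal{H}(S): P+s\in S \text{ for all } s\in S\setminus\{0\}\}$ and the type is $t(S)=|PF(S)|$. $\mathcal{S}_g$ denotes the (finite) set of numerical semigroups of genus $g$, and $\mathbb{P}_g$ is the uniform probability distribution on $\mathcal{S}_g$ (with $S$ a random element of $\mathcal{S}_g$). *)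

(* Defs.v *)
From HB Require Import structures.
From mathcomp Require Import all_boot all_order all_algebra.
From mathcomp Require Import boolp classical_sets functions cardinality reals ereal topology normedtype sequences.
From mathcomp Require Import finmap.
Set Implicit Arguments. Unset Strict Implicit. Unset Printing Implicit Defensive.
Import Order.TTheory GRing.Theory Num.Theory.
Import numFieldNormedType.Exports.
Local Open Scope classical_set_scope.
Local Open Scope ring_scope.
Local Open Scope fset_scope.

Definition numerical_semigroup (S : set nat) : Prop :=
  [/\ S 0%N, (forall a b, S a -> S b -> S (a + b)%N) & finite_set (~` S)].

Definition gaps (S : set nat) : set nat := ~` S.
Definition genus (S : set nat) : nat := #|` fset_set (gaps S)|.

Definition min_gens (S : set nat) : set nat :=
  [set n | [/\ S n, (0 < n)%N &
     ~ (exists a b, [/\ S a, (0 < a)%N, S b, (0 < b)%N & n = (a + b)%N])]].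
Definition edim (S : set nat) : nat := #|` fset_set (min_gens S)|.

Definition pseudo_frobenius (S : set nat) : set nat :=
  [set P | gaps S P /\ (forall s, S s -> (0 < s)%N -> S (P + s)%N)].
Definition stype (S : set nat) : nat := #|` fset_set (pseudo_frobenius S)|.

Definition semigroups_of_genus (g : nat) : set (set nat) :=
  [set S | numerical_semigroup S /\ genus S = g].

Definition prob_g (R : realType) (g : nat) (A : set (set nat)) : R :=
  (#|` fset_set (semigroups_of_genus g `&` A)|)%:R
    / (#|` fset_set (semigroups_of_genus g)|)%:R.

(* Main.v *)
(** Fix large constants [t] and [K] with [t / K] small. A numerical semigroup [S] of genus [g], with gap
set [G], is encoded up to [exp(o(g))] choices by a fingerprint: the set [P] of its
first [K] positive elements, all below [M], and a small set [Q] of gaps and minimal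
generators chosen greedily. If [q] is a gap or a minimal generator and [s] is a
positive element of [S], then [q - s] is not a positive element of [S]; so the
fingerprint determines a set [O] of gaps, and maximality of [Q] forces every other
gap, and every minimal generator beyond [M], into a set [U] of numbers [u] such that
[u - p] lies in [O] for all but [t] elements [p] of [P]. Since [O] is closed under
subtraction of elements of [P], [U] has essentially at most one element in each
residue class modulo some [p] in [P], whence [|U| <= M + o(g) <= |O| + o(g)].

Give [S] the weight [z ^ g] with [z + z ^ 2 = 1]. The semigroups with a given
fingerprint weigh at most [z ^ |O| * (1 + z) ^ |U| = (1 + z) ^ (|U| - |O|)], which is
subexponential, while all semigroups of genus [g] together weigh at least
[z / (g + 1)]. Hence any further condition that costs an exponential factor can be
discarded: [U] misses many elements of [[M, 2M)]; [|G| - |O|] is not close to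
[z ^ 2 * |U|]; there is an element of [S] well below [M], or a gap well above [2M]
(each of these forbids one configuration on linearly many disjoint pairs of elements
of [U]). What remains has [O] close to [[1, M)], [U] close to [[M, 2M)], and there
almost every element of [U] in [S] is a minimal generator and almost every gap in [U]
is pseudo-Frobenius. *)
Require Import Defs.
From HB Require Import structures.
From mathcomp Require Import all_boot all_order all_algebra.
From mathcomp Require Import boolp reals sequences exp.
From mathcomp Require Import zify ring lra.
Set Implicit Arguments. Unset Strict Implicit. Unset Printing Implicit Defensive.

(** * Fingerprints of gap sets *)

(** A largest [Q] satisfying the cardinality inequality works: an [a] with [t] uncovered elements
    could still be added. As the union lies in [T], [Q] has at most [#|T| / t] elements, so there
    are few choices for it. *)
Lemma greedy_cover (T : finType) (A : {set T}) (Phi : T -> {set T}) (t : nat) :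
  (0 < t)%N ->
  exists Q : {set T}, [/\ Q \subset A,
    (t * #|Q| <= #|\bigcup_(q in Q) Phi q|)%N &
    forall a, a \in A -> (#|Phi a :\: \bigcup_(q in Q) Phi q| < t)%N].
Proof.
move=> t0.
pose ok (Q : {set T}) := (Q \subset A) && (t * #|Q| <= #|\bigcup_(q in Q) Phi q|)%N.
have ok0 : ok set0 by rewrite /ok sub0set cards0 muln0.
case: (arg_maxnP (fun Q : {set T} => #|Q|) ok0) => Q /andP[QA Qt] Qmax.
exists Q; split=> // a aA; rewrite ltnNge; apply/negP => ta.
have aQ : a \notin Q.
  apply/negP => aQ; move: ta; rewrite leqNgt => /negP; apply.
  by rewrite (_ : _ :\: _ = set0) ?cards0 //; apply/eqP; rewrite setD_eq0 bigcup_sup.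
suff /Qmax : ok (a |: Q) by rewrite /= cardsU1 aQ add1n /= ltnn.
rewrite /ok subUset sub1set aA QA cardsU1 aQ /= mulnDr muln1 bigcup_setU big_set1.
rewrite setUC (_ : _ :|: _ = (\bigcup_(i in Q) Phi i) :|: (Phi a :\: \bigcup_(i in Q) Phi i)).
  rewrite cardsU (_ : _ :&: _ = set0) ?cards0 ?subn0 1?addnC ?leq_add //.
  by apply/setP => x; rewrite !inE; case: (x \in \bigcup_(i in Q) _).
by apply/setP => x; rewrite !inE; case: (x \in \bigcup_(i in Q) _); rewrite ?orbT ?orbF.
Qed.

Lemma card_ord_interval (n a b : nat) : (b <= n)%N ->
  #|[set i : 'I_n | (a <= i < b)%N]| = (b - a)%N.
Proof.
move=> bn; rewrite -sum1_card.
under eq_bigl do rewrite inE.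
rewrite -(big_mkord (fun i => a <= i < b)%N (fun=> 1%N)).
rewrite -[RHS]muln1 -sum_nat_const_nat.
rewrite [RHS](big_nat_widen _ _ n) // [RHS](big_nat_widenl _ 0) //.
by apply: eq_bigl => i; rewrite andbC.
Qed.

Section GapSets.
Variables (N : nat).
Local Notation T := 'I_N.+1.
Implicit Types (G O P Q V : {set T}) (M t K g : nat).

(* The semigroup is the complement of [G] in [nat], not in ['I_N.+1]: every number
   above [N] belongs to it. *)
Definition in_compl G (n : nat) : bool := [forall i in G, val i != n].

Definition gap_set G : Prop :=
  in_compl G 0 /\ forall a b, in_compl G a -> in_compl G b -> in_compl G (a + b).

(** Summands of a number up to [N] are themselves at most [N], so bounding [a] and [b] loses
    nothing. Only generators up to [N] are recorded; [edim_compl_gaps] shows when these are all. *)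
Definition gens G : {set T} :=
  [set n : T | [&& (0 < n)%N, n \notin G &
     ~~ [exists a : T, exists b : T,
          [&& (0 < a)%N, (0 < b)%N, a \notin G, b \notin G & (a + b)%N == n :> nat]]]].

Definition pfs G : {set T} :=
  [set n in G | [forall s : T, ((0 < s)%N && (s \notin G)) ==> in_compl G (n + s)]].

Definition osub (n p : T) : T := Ordinal (leq_ltn_trans (leq_subr p n) (ltn_ord n)).

Definition shifts_down P (n : T) : {set T} := [set osub n p | p : T in P & (p < n)%N].
(** In its uses [n] and [p] are below [M <= 2 * g] and [4 * g <= N], so the default value of [inord]
    does not occur. *)
Definition shifts_up P (n : T) : {set T} := [set (inord (n + p) : T) | p : T in P].

(* Sums of arbitrary lists from [P], rather than single elements, are subtracted so that
   this set is itself closed under subtraction of elements of [P]. *)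
Definition forced_out M P Q : {set T} :=
  [set n : T | (0 < n)%N && (((n < M)%N && (n \notin P)) ||
     `[< exists q (l : seq T), [/\ q \in Q, l != [::], all (mem P) l
            & (n + sumn (map val l))%N = q] >])].

Definition undecided t M P Q : {set T} :=
  [set n : T | [&& (M <= n)%N, n \notin forced_out M P Q &
     (#|shifts_down P n :\: forced_out M P Q| < t)%N]].

(* [V] is a small set of pseudo-Frobenius numbers below [M]; it serves to show that there
   are few of them: each would force almost all of its shifts by [P] into the semigroup. *)
Definition forced_in P V : {set T} := \bigcup_(v in V) shifts_up P v.

Definition free t M P Q V : {set T} := undecided t M P Q :\: forced_in P V.

(** [forced_out] and [free] depend on [M], [P], [Q], [V] alone; by [fp_out] and [fp_gaps], such a
    [G] is determined by the subset of [free] that it adds to [forced_out]. *)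
Record fingerprint t K g M P Q V G : Prop := Fingerprint {
  fp_M : (M <= 2 * g)%N;
  fp_P : P = [set n : T | [&& (0 < n)%N, (n < M)%N & n \notin G]];
  fp_K : #|P| = K;
  fp_V : forall v, v \in V -> (v < M)%N;
  fp_sizeQ : (t * #|Q| <= N.+1)%N;
  fp_sizeV : (t * #|V| <= N.+1)%N;
  fp_out : forced_out M P Q \subset G;
  fp_gaps : G \subset forced_out M P Q :|: free t M P Q V;
  fp_gens : gens G \subset P :|: undecided t M P Q;
  fp_in : [disjoint forced_in P V & G];
  fp_pfs : forall n, n \in pfs G -> (n < M)%N -> (#|shifts_up P n :\: forced_in P V| < t)%N
}.

Lemma in_compl_ord G (i : T) : in_compl G i = (i \notin G).
Proof.
apply/forall_inP/idP => [H|iG j jG].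
  by apply/negP => /H; rewrite eqxx.
by apply: contraNneq iG => /val_inj <-.
Qed.

Lemma in_compl_big G n : (N < n)%N -> in_compl G n.
Proof. by move=> Nn; apply/forall_inP => i _; rewrite neq_ltn (leq_trans (ltn_ord i)). Qed.

Lemma gap_set0 G (i : T) : gap_set G -> i \in G -> (0 < i)%N.
Proof.
move=> [G0 _] iG; rewrite lt0n; apply: contraTneq iG => i0.
by rewrite -in_compl_ord i0.
Qed.

Lemma in_compl_sumn G (l : seq T) : gap_set G -> all (fun i => i \notin G) l ->
  in_compl G (sumn (map val l)).
Proof.
move=> [G0 GD]; elim: l => //= i l IH /andP[iG /IH Hl].
by apply: GD => //; rewrite in_compl_ord.
Qed.

(** If [i] is a gap, then for every [j <= i] one of [j] and [i - j] is a gap, so [G] and its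
    reflection cover the [i + 1] numbers up to [i]. *)
Lemma gap_lt_double G (i : T) : gap_set G -> i \in G -> (i < 2 * #|G|)%N.
Proof.
move=> sG iG; rewrite ltnNge; apply/negP => Gi.
have cI : #|[set j : T | (0 <= j < i.+1)%N]| = i.+1 by rewrite card_ord_interval // subn0.
suff : (i.+1 <= 2 * #|G|)%N by move=> /leq_trans/(_ Gi); rewrite ltnn.
have : [set j : T | (0 <= j < i.+1)%N] \subset G :|: [set osub i j | j in G].
  apply/subsetP => j; rewrite !inE /= ltnS => ji.
  have [//|jG /=] := boolP (j \in G); apply/imsetP; exists (osub i j).
    apply: contraLR iG; rewrite -!in_compl_ord => ijG.
    by rewrite -(subnK ji) addnC; case: sG => _; apply; rewrite ?in_compl_ord.
  by apply: val_inj => /=; rewrite subKn.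
move=> /subset_leq_card; rewrite cI => /leq_trans; apply.
by rewrite mul2n -addnn (leq_trans (leq_card_setU _ _)) // leq_add2l leq_imset_card.
Qed.

(** Discrete continuity: the number of positive elements below [M] grows by at most one per step and
    is at least [g - 1 >= K] at [2 * g]. *)
Lemma initial_segment G g K : gap_set G -> #|G| = g -> (2 * g <= N)%N -> (K < g)%N ->
  exists2 M, (M <= 2 * g)%N & #|[set n : T | [&& (0 < n)%N, (n < M)%N & n \notin G]]| = K.
Proof.
move=> sG Gg gN Kg; pose f M := #|[set n : T | [&& (0 < n)%N, (n < M)%N & n \notin G]]|.
have fg : (K <= f (2 * g))%N.
  have : [set n : T | (1 <= n < 2 * g)%N] \subset
      G :|: [set n : T | [&& (0 < n)%N, (n < 2 * g)%N & n \notin G]].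
    by apply/subsetP => n; rewrite !inE => /andP[-> ->] /=; case: (n \in G).
  move=> /subset_leq_card; rewrite card_ord_interval; last by rewrite leqW.
  move=> /leq_trans /(_ (leq_card_setU _ _)); rewrite Gg -/(f _); lia.
have ex : exists M, (K <= f M)%N by exists (2 * g)%N.
case: (ex_minnP ex) => M fM Mmin; exists M; first exact: Mmin.
apply/eqP; rewrite -/(f M) eqn_leq fM andbT.
case: M fM Mmin => [|M] fM Mmin.
  by rewrite /f (eq_card0) // => n; rewrite !inE andbF.
have fK : (f M < K)%N by rewrite ltnNge; apply/negP => /Mmin; rewrite ltnn.
apply: leq_trans fK; rewrite -[leqRHS]addn1.
have : [set n : T | [&& (0 < n)%N, (n < M.+1)%N & n \notin G]] \subset
    [set n : T | [&& (0 < n)%N, (n < M)%N & n \notin G]] :|: [set n : T | (M <= n < M.+1)%N].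
  by apply/subsetP => n; rewrite !inE => /and3P[-> nM ->] /=; lia.
move=> /subset_leq_card /leq_trans; apply; apply: leq_trans (leq_card_setU _ _) _.
rewrite leq_add2l card_ord_interval; last by have := Mmin _ fg; lia.
by rewrite subSn // subnn.
Qed.

Lemma forced_out_down M P Q (q : T) : q \in Q -> shifts_down P q \subset forced_out M P Q.
Proof.
move=> qQ; apply/subsetP => x /imsetP[p]; rewrite inE => /andP[pP pq] ->.
rewrite inE /= subn_gt0 pq /=; apply/orP; right; apply/asboolP.
by exists q, [:: p]; split; rewrite //= ?pP // addn0 subnK // ltnW.
Qed.

(** If [n] were in the semigroup, [q = n + sumn l] would be a sum of two positive elements, hence
    neither a gap nor a minimal generator. *)
Lemma forced_out_subset G M P Q : gap_set G ->
  P = [set n : T | [&& (0 < n)%N, (n < M)%N & n \notin G]] ->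
  Q \subset G :|: gens G -> forced_out M P Q \subset G.
Proof.
move=> sG PE QG; apply/subsetP => n; rewrite inE => /andP[n0 /orP[/andP[nM]|/asboolP]].
  by rewrite PE inE n0 nM negbK.
move=> [q [l [qQ l0 lP qE]]]; have [//|nG] := boolP (n \in G).
have lG : all (fun i => i \notin G) l.
  by apply/allP => i /(allP lP); rewrite /= PE inE => /and3P[].
have sl0 : (0 < sumn (map val l))%N.
  case: l l0 lP {qE lG} => //= i l _ /andP[+ _]; rewrite PE inE => /and3P[i0 _ _].
  by rewrite addn_gt0 i0.
have slG := in_compl_sumn sG lG.
have := subsetP QG _ qQ; rewrite inE => /orP[qG|].
  have := (proj2 sG) n _ _ slG; rewrite in_compl_ord qE in_compl_ord qG.
  by move/(_ nG).
rewrite inE => /and3P[q0 qG /existsPn /(_ n)].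
have slN : (sumn (map val l) < N.+1)%N by rewrite (leq_ltn_trans _ (ltn_ord q)) // -qE leq_addl.
move=> /existsPn /(_ (Ordinal slN)); rewrite n0 nG /= sl0 qE eqxx andbT /=.
by rewrite -in_compl_ord /= slG.
Qed.

Lemma fingerprint_exists t K g G : gap_set G -> #|G| = g -> (4 * g <= N)%N -> (K < g)%N ->
  (0 < t)%N -> exists M P Q V, fingerprint t K g M P Q V G.
Proof.
move=> sG Gg gN Kg t0.
have [||M Mg cP] := initial_segment (K := K) sG Gg; [by lia | by [] |].
pose P := [set n : T | [&& (0 < n)%N, (n < M)%N & n \notin G]].
have [Q [QA Qt Qmax]] := greedy_cover (G :|: gens G) (shifts_down P) t0.
have [V [VA Vt Vmax]] := greedy_cover [set n in pfs G | (n < M)%N] (shifts_up P) t0.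
have cT (A : {set T}) : (#|A| <= N.+1)%N by rewrite -[leqRHS]card_ord max_card.
have OG : forced_out M P Q \subset G by exact: forced_out_subset.
have QO n : n \in G :|: gens G -> (#|shifts_down P n :\: forced_out M P Q| < t)%N.
  move=> /Qmax; apply: leq_ltn_trans; apply/subset_leq_card/setDS/bigcupsP => q.
  exact: forced_out_down.
(* A pseudo-Frobenius number plus an element of [P] lies in the semigroup. *)
have VD : [disjoint forced_in P V & G].
  rewrite disjoint_subset; apply/subsetP => x /bigcupP[v /(subsetP VA)].
  rewrite inE => /andP[vpf vM] /imsetP[p]; rewrite inE => /and3P[p0 pM pG] ->.
  rewrite inE -in_compl_ord inordK; last by lia.
  by move: vpf; rewrite inE => /andP[_ /forallP /(_ p)]; rewrite p0 pG.
exists M, P, Q, V; split => //.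
- by move=> v /(subsetP VA); rewrite inE => /andP[].
- exact: leq_trans Qt (cT _).
- exact: leq_trans Vt (cT _).
- apply/subsetP => n nG; rewrite in_setU !in_setD [in X in _ || X]inE (QO n); last by rewrite inE nG.
  have [//|nO /=] := boolP (n \in forced_out M P Q).
  rewrite andbT (disjointFl VD nG) /=; rewrite leqNgt; apply: contra nO => nM.
  by rewrite inE nM inE nG (gap_set0 sG nG) andbF.
- apply/subsetP => n ng; rewrite in_setU [in X in _ || X]inE (QO n); last by rewrite inE ng orbT.
  move: ng; rewrite inE => /and3P[n0 nG _]; rewrite inE n0 nG andbT.
  by case: ltnP => //= _; rewrite andbT; apply: contra nG => /(subsetP OG).
- by move=> n npf nM; apply: Vmax; rewrite inE npf.
Qed.

End GapSets.

(* Cardinals of sets over ['I_N.+1] may differ by an invisible [reverse_coercion], which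
   [lia] does not see through. *)
Local Ltac clia := unfold reverse_coercion in *; lia.

(** * Structure of a gap set with a given fingerprint *)

Definition below (N m : nat) : {set 'I_N.+1} := [set n : 'I_N.+1 | (n < m)%N].

Section Structure.
Variables (N t d g M : nat) (P Q V G : {set 'I_N.+1}).
Local Notation T := 'I_N.+1.
Local Notation K := (t * t)%N.
Local Notation O := (forced_out M P Q).
Local Notation U := (undecided t M P Q).
Local Notation D := (forced_in P V).
Local Notation L := (free t M P Q V).

Hypothesis sG : gap_set G.
Hypothesis Gg : #|G| = g.
Hypothesis gN : (4 * g <= N)%N.
Hypothesis t2 : (2 <= t)%N.
Hypothesis Nd : (N.+1 <= t * d)%N.
Hypothesis Kd : (K * K + K + 1 <= d)%N.
Hypothesis fp : fingerprint t K g M P Q V G.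

Let t0 : (0 < t)%N. Proof. exact: ltnW. Qed.

Let P_pos p : p \in P -> (0 < p)%N.
Proof. by rewrite (fp_P fp) inE => /and3P[]. Qed.

Let P_lt p : p \in P -> (p < M)%N.
Proof. by rewrite (fp_P fp) inE => /and3P[]. Qed.

Let P_compl p : p \in P -> p \notin G.
Proof. by rewrite (fp_P fp) inE => /and3P[]. Qed.

Let undecided_ge u : u \in U -> (M <= u)%N.
Proof. by rewrite inE => /and3P[]. Qed.

(** [y] is not in [P], since otherwise [x] would be in the semigroup; this settles the case [x < M].
    In the other case [k] copies of [p] are added to the list that witnesses [x]. *)
Lemma forced_out_closed (x y p : T) k : x \in O -> p \in P -> (0 < y)%N ->
  (y + k * p)%N = x -> y \in O.
Proof.
move=> xO pP y0 yx.
have xG := subsetP (fp_out fp) _ xO.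
have yP : y \notin P.
  apply: contraL xG => /P_compl yG; rewrite -in_compl_ord -yx.
  have := in_compl_sumn (l := y :: nseq k p) sG.
  rewrite /= yG map_nseq sumn_nseq mulnC; apply.
  by apply/allP => i /nseqP[-> _]; exact: P_compl.
move: xO; rewrite !inE y0 yP andbT => /andP[_ /orP[/andP[xM _]|/asboolP[q [l [qQ l0 lP qE]]]]].
  by rewrite (leq_ltn_trans _ xM) // -yx leq_addr.
apply/orP; right; apply/asboolP; exists q, (nseq k p ++ l); split => //.
- by case: (l) l0 => // i l' _; case: k {yx}.
- by rewrite all_cat lP andbT; apply/allP => i /nseqP[-> _].
- by rewrite map_cat sumn_cat map_nseq sumn_nseq addnA mulnC yx.
Qed.

Definition good_undecided (p : T) : {set T} := [set u in U | osub u p \in O].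

(** Double counting: each [u] in [U] has fewer than [t] bad [p]. If each of the [K = t * t] elements
    [p] had more than [d] bad [u], then [K * (d + 1) <= t * #|U| <= t * t * d]. *)
Lemma exists_good_shift : exists2 p, p \in P & (#|U :\: good_undecided p| <= d)%N.
Proof.
have sum_le : (\sum_(p in P) #|U :\: good_undecided p| <= t * #|U|)%N.
  have -> : (\sum_(p in P) #|U :\: good_undecided p| =
      \sum_(u in U) \sum_(p in P | osub u p \notin O) 1)%N.
    under eq_bigr do rewrite -sum1_card.
    rewrite (exchange_big_dep (mem U)) /=; last by move=> p u _; rewrite !inE => /andP[_ ->].
    apply: eq_bigr => u uU; apply: eq_bigl => p.
    by rewrite !in_setD in_set uU /= andbT.
  rewrite mulnC -sum_nat_const; apply: leq_sum => u uU.
  have := uU; rewrite inE => /and3P[Mu _]; move/ltnW; apply: leq_trans.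
  rewrite sum1_card -(card_in_imset (f := osub u)); last first.
    move=> p p' /andP[/P_lt pM _] /andP[/P_lt pM' _] /(congr1 val) /= e.
    by apply: val_inj => /=; lia.
  apply/subset_leq_card/subsetP => x /imsetP[p /andP[pP pO] ->].
  rewrite inE pO; apply/imsetP; exists p => //.
  by rewrite inE pP (leq_trans (P_lt pP)).
have cP := fp_K fp.
have UN : (#|U| <= N.+1)%N by rewrite -[leqRHS]card_ord max_card.
apply: contrapT => /forallPNP H.
have : (\sum_(p in P) d.+1 <= \sum_(p in P) #|U :\: good_undecided p|)%N.
  by apply: leq_sum => p pP; rewrite ltnNge; apply/negP/H.
rewrite sum_nat_const cP => /leq_trans/(_ sum_le); nia.
Qed.

(** Reduction modulo [p] is injective here: if [u' < u] are congruent, then [u'] arises from [u - p]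
    in [O] by subtracting multiples of [p], so [u'] would lie in [O]. *)
Lemma card_good_undecided p : p \in P -> (#|good_undecided p| <= p)%N.
Proof.
move=> pP; have p0 := P_pos pP.
rewrite -(card_in_imset (f := fun u : T => inord (u %% p) : T)); last first.
  have wlog_lt u u' : u \in good_undecided p -> u' \in good_undecided p ->
      (u' < u)%N -> (u %% p = u' %% p)%N -> False.
    rewrite in_set => /andP[uU uO]; rewrite in_set => /andP[]; rewrite in_set => /and3P[Mu' u'O _] _ u'u uu'.
    have := ltn_ord u; have := ltn_ord u'.
    move=> _ _; move/negP: u'O; apply.
    (* The multiple is counted from [u - p], not from [u], hence the predecessor. *)
    apply: (forced_out_closed (k := (u %/ p - u' %/ p).-1) uO pP) => /=.
      by rewrite (leq_trans _ Mu') // (leq_trans _ (P_lt pP)).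
    have e1 := divn_eq u p; have e2 := divn_eq u' p.
    have : (u' %/ p < u %/ p)%N by rewrite ltnNge; apply/negP => h; nia.
    by move=> h; nia.
  move=> u u' hu hu' /(congr1 val) /=.
  have lN (x : T) : (x %% p < N.+1)%N by rewrite (leq_ltn_trans (leq_mod _ _)).
  rewrite !inordK ?lN // => e; apply: val_inj => /=.
  by case: (ltngtP u u') => // h; [case: (wlog_lt u' u) | case: (wlog_lt u u')].
have pN : (p <= N.+1)%N by exact: ltnW (ltn_ord p).
apply: leq_trans (_ : #|[set n : T | (0 <= n < p)%N]| <= p)%N; last first.
  by rewrite card_ord_interval ?subn0.
apply/subset_leq_card/subsetP => x /imsetP[u _ ->]; rewrite inE inordK ?ltn_pmod //.
by rewrite (leq_ltn_trans (leq_mod _ _)).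
Qed.

Lemma card_undecided : (#|U| <= M + d)%N.
Proof.
have [p pP pd] := exists_good_shift.
have /subset_leq_card : U \subset good_undecided p :|: (U :\: good_undecided p).
  by apply/subsetP => u uU; rewrite !in_setU in_setD uU andbT orbN.
move=> /leq_trans/(_ (leq_card_setU _ _)).
have := card_good_undecided pP; have := P_lt pP; clia.
Qed.

Let M_le : (M <= N)%N. Proof. by have := fp_M fp; clia. Qed.

Lemma card_forced_out_low : (M <= #|O :&: (below N M)| + K + 1)%N.
Proof.
have : [set n : T | (1 <= n < M)%N] \subset (O :&: (below N M)) :|: P.
  apply/subsetP => n; rewrite !inE => /andP[n0 nM].
  by have [//|nP] := boolP (n \in P); rewrite ?orbT // n0 nM.
move=> /subset_leq_card; rewrite card_ord_interval; last exact: leqW.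
move=> /leq_trans/(_ (leq_card_setU _ _)); rewrite (fp_K fp); clia.
Qed.

Lemma card_forced_out_high : (#|O :\: (below N M)| + M <= #|O| + K + 1)%N.
Proof.
by have := card_forced_out_low; have := cardsID (below N M) O; clia.
Qed.

Lemma card_forced_out_ge : (M <= #|O| + d)%N.
Proof. by have := card_forced_out_high; clia. Qed.

(** Up to [d] exceptions, subtracting the good [p < M] maps the undecided numbers from [2 * M] on
    injectively into the part of [O] at or above [M]. *)
Lemma card_undecided_high : (#|U :\: (below N (2 * M))| + M <= #|O| + 2 * d)%N.
Proof.
have [p pP pd] := exists_good_shift.
have : U :\: (below N (2 * M)) \subset (U :\: good_undecided p) :|:
   [set u in good_undecided p | (2 * M <= u)%N].
  apply/subsetP => u; rewrite !in_setU !in_setD [u \in [set _ in _ | _]]inE inE -leqNgt => /andP[-> ->].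
  by rewrite !andbT orNb.
move=> /subset_leq_card /leq_trans /(_ (leq_card_setU _ _)).
have : (#|[set u in good_undecided p | (2 * M <= u)%N]| <= #|O :\: (below N M)|)%N.
  rewrite -(card_in_imset (f := fun u => osub u p)).
    apply/subset_leq_card/subsetP => x /imsetP[u /setIdP[/setIdP[_ uO] uM] ->].
    by rewrite in_setD uO andbT inE -leqNgt /=; have := P_lt pP; clia.
  move=> u u' /setIdP[_ h] /setIdP[_ h'] /(congr1 val) /= e.
  by apply: val_inj => /=; have := P_lt pP; clia.
have := card_forced_out_high; clia.
Qed.

Let free_undecided : L \subset U. Proof. exact: subsetDl. Qed.

Lemma card_free_le : (#|L| <= #|O| + 2 * d)%N.
Proof.
have := subset_leq_card free_undecided; have := card_undecided; have := card_forced_out_ge.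
clia.
Qed.

(** * Position of the free set when it is not much smaller than [forced_out] *)

Hypothesis Hl : (#|O| < #|L| + d)%N.

Let outM : (#|O| < M + 2 * d)%N.
Proof. by have := subset_leq_card free_undecided; have := card_undecided; clia. Qed.

Definition middle : {set T} := [set n : T | (M <= n < 2 * M)%N].

Lemma card_free_high : (#|L :\: middle| <= 4 * d)%N.
Proof.
have : L :\: middle \subset U :\: below N (2 * M).
  apply/subsetP => n; rewrite !in_setD [n \in middle]inE [n \in below _ _]inE.
  by move=> /and3P[+ nD nU]; rewrite nU (undecided_ge nU) andbT.
by move=> /subset_leq_card; have := card_undecided_high; clia.
Qed.

(** [middle] has [M] elements, [L] has more than [M - 2 * d], and at most [4 * d] of these lie
    outside [middle]. *)
Lemma card_free_missing : (#|middle :\: L| <= 6 * d)%N.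
Proof.
have := cardsID middle L; have := cardsID L middle; rewrite setIC.
rewrite /middle card_ord_interval -/middle; last by have := fp_M fp; lia.
have := card_free_high; have := card_forced_out_ge; clia.
Qed.

Let gaps_out : #|G :\: O| = (g - #|O|)%N.
Proof. by rewrite cardsD (setIidPr (fp_out fp)) Gg. Qed.

Let out_le : (#|O| <= g)%N.
Proof. by rewrite -Gg; apply/subset_leq_card/(fp_out fp). Qed.

Let gaps_free n : n \in G -> n \notin O -> n \in L.
Proof. by move=> /(subsetP (fp_gaps fp)); rewrite in_setU => /orP[->|]. Qed.

Lemma card_gens_le : (#|gens G| + g <= M + #|O| + 2 * d)%N.
Proof.
have : gens G \subset P :|: (U :\: (G :\: O)).
  apply/subsetP => n ng; have nG : n \notin G by move: ng; rewrite inE => /and3P[].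
  have := subsetP (fp_gens fp) _ ng; rewrite !in_setU => /orP[->//|nU].
  by rewrite !in_setD nU (negPf nG) andbF orbT.
move=> /subset_leq_card /leq_trans /(_ (leq_card_setU _ _)).
have GOU : G :\: O \subset U.
  by apply/subsetP => n /setDP[nG nO]; apply: (subsetP free_undecided); exact: gaps_free.
rewrite (fp_K fp) cardsD (setIidPr GOU).
by have := subset_leq_card GOU; have := card_undecided; have := out_le; rewrite gaps_out; clia.
Qed.

(** The input of [subset_weight_pairs]; [10 * d] pairs save more than [golden_weight_le] loses. *)
Definition pairing (B : {set T}) (h : T -> T) : Prop :=
  [/\ {in B &, injective h}, B \subset L, h @: B \subset L, [disjoint B & h @: B]
    & (10 * d <= #|B|)%N].

(** At most [6 * d] pairs are lost because [y] is not in [L], and as many because of [h y]; this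
    leaves [22 - 2 * 6 = 10] times [d]. *)
Lemma restrict_pairs (W : {set T}) (h : T -> T) :
  W \subset middle -> h @: W \subset middle -> {in W &, injective h} ->
  (22 * d <= #|W|)%N -> [disjoint W & h @: W] ->
  pairing [set y in W | (y \in L) && (h y \in L)] h.
Proof.
move=> Wm hWm hI cW dW; set B := [set _ in _ | _].
have BW : B \subset W by apply/subsetP => y; rewrite inE => /andP[].
split.
- by move=> x y /(subsetP BW) xW /(subsetP BW) yW; exact: hI.
- by apply/subsetP => y; rewrite inE => /and3P[].
- by apply/subsetP => x /imsetP[y + ->]; rewrite inE => /and3P[].
- exact: disjointWl BW (disjointWr (imsetS _ BW) dW).
have : W \subset B :|: (middle :\: L) :|: [set y in W | h y \in middle :\: L].
  apply/subsetP => y yW; have hyW : h y \in middle by rewrite (subsetP hWm) ?imset_f.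
  have yB : (y \in B) = (y \in L) && (h y \in L) by rewrite in_set yW.
  have yH : (y \in [set y in W | h y \in middle :\: L]) = (h y \notin L).
    by rewrite in_set yW in_setD hyW andbT.
  rewrite !in_setU in_setD (subsetP Wm _ yW) andbT yB yH.
  by case: (y \in L); case: (h y \in L).
move=> /subset_leq_card /leq_trans /(_ (leq_card_setU _ _)).
have := leq_of_leqif (leq_card_setU B (middle :\: L)).
have : (#|[set y in W | h y \in middle :\: L]| <= #|middle :\: L|)%N.
  rewrite -(card_in_imset (f := h)).
    by apply/subset_leq_card/subsetP => x /imsetP[y /setIdP[_ ?] ->].
  by move=> x y /setIdP[xW _] /setIdP[yW _]; exact: hI.
have := card_free_missing; clia.
Qed.

(* Taking every other block of length [p] makes the pairs [(y, y + p)] disjoint. *)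
Lemma shift_pairs (p : T) : p \in P -> (p + 50 * d <= M)%N ->
  exists B h, pairing B h /\ forall y, y \in B -> h y = (y + p)%N :> nat.
Proof.
move=> pP pM; have p0 := P_pos pP; have M2g := fp_M fp.
pose W (b : bool) := [set y : T | (M <= y < 2 * M - p)%N && (odd ((y - M) %/ p) == b)].
pose h (y : T) : T := inord (y + p).
have hE (y : T) b : y \in W b -> h y = (y + p)%N :> nat.
  by rewrite inE => /andP[/andP[_ y1] _]; rewrite inordK //; clia.
have hI b : {in W b &, injective h}.
  move=> x y xW yW /(congr1 val) /=; rewrite (hE _ _ xW) (hE _ _ yW) => e.
  by apply: val_inj => /=; clia.
exists [set y in W false | (y \in L) && (h y \in L)], h; split; last first.
  by move=> y; rewrite inE => /andP[yW _]; exact: hE yW.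
have hodd (y : T) : y \in W false -> odd ((h y - M) %/ p).
  move=> yW; rewrite (hE _ _ yW); move: yW; rewrite inE => /andP[/andP[My _] /eqP].
  have -> : (y + p - M = 1 * p + (y - M))%N by clia.
  by rewrite divnMDl // oddD => ->.
apply: restrict_pairs.
- by apply/subsetP => y; rewrite !inE => /andP[/andP[-> y1] _]; clia.
- apply/subsetP => x /imsetP[y yW ->]; rewrite inE (hE _ _ yW).
  by move: yW; rewrite inE => /andP[/andP[My y1] _]; clia.
- exact: hI.
- have : [set y : T | (M <= y < 2 * M - p)%N] \subset W false :|: W true.
    by apply/subsetP => y; rewrite !inE => ->; case: odd.
  move=> /subset_leq_card; rewrite card_ord_interval; last by clia.
  move=> /leq_trans /(_ (leq_card_setU _ _)).
  (* Moving odd blocks down by [p] embeds them in the even ones, which therefore fill at least half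
     of an interval of at least [50 * d] numbers. *)
  suff : (#|W true| <= #|W false|)%N by clia.
  have Wp (y : T) : y \in W true -> (M + p <= y)%N.
    rewrite inE => /andP[/andP[My _] /eqP]; case: (ltnP y (M + p)) => // yM.
    by rewrite divn_small //; clia.
  rewrite -(card_in_imset (f := fun y => osub y p)).
    apply/subset_leq_card/subsetP => x /imsetP[y yW ->]; have := Wp _ yW.
    move: yW; rewrite !inE /= => /andP[/andP[My y1] /eqP o] yp.
    have e : (y - M = 1 * p + (y - p - M))%N by clia.
    move: o; rewrite e divnMDl // oddD /=; case: odd => // _; rewrite eqxx andbT; clia.
  move=> x y /Wp xW /Wp yW /(congr1 val) /= e; apply: val_inj => /=; clia.
- rewrite disjoint_subset; apply/subsetP => y yW; rewrite inE; apply/imsetP => -[x /hodd + yE].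
  by rewrite -yE; move: yW; rewrite inE => /andP[_ /eqP ->].
Qed.

(** The pairs are [y] and [n - y] with [M <= y] and [2 * y < n], at least [25 * d] in number;
    [n < 3 * M] keeps [n - y] below [2 * M]. *)
Lemma reflect_pairs (n : T) : (2 * M + 50 * d <= n)%N -> (n < 3 * M)%N ->
  exists B h, pairing B h /\ forall y, y \in B -> (y + h y)%N = n :> nat.
Proof.
move=> Mn nM; pose W := [set y : T | (M <= y < uphalf n)%N].
have n2 : (uphalf n <= n)%N by have := fp_M fp; rewrite leq_uphalf_double; clia.
have hW (y : T) : y \in W -> (2 * y < n)%N.
  by rewrite inE => /andP[_]; rewrite ltnNge leq_uphalf_double -ltnNge; clia.
have MW (y : T) : y \in W -> (M <= y)%N by rewrite inE => /andP[].
exists [set y in W | (y \in L) && (osub n y \in L)], (osub n); split; last first.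
  by move=> y; rewrite inE => /andP[/hW yW _] /=; clia.
have ltn := ltn_ord n.
have d0 : (0 < d)%N by clia.
apply: restrict_pairs.
- by apply/subsetP => y yW; have := hW _ yW; have := MW _ yW; rewrite inE; clia.
- by apply/subsetP => x /imsetP[y yW ->]; have := hW _ yW; have := MW _ yW; rewrite inE /=; clia.
- move=> x y /hW xn /hW yn /(congr1 val) /= e; apply: val_inj => /=; clia.
- rewrite card_ord_interval; last by clia.
  by have := odd_double_half n; rewrite uphalf_half; clia.
- rewrite disjoint_subset; apply/subsetP => y yW; rewrite inE; apply/imsetP => -[x xW].
  by move/(congr1 val) => /=; have := hW _ yW; have := hW _ xW; clia.
Qed.

Hypothesis Hp : forall p, p \in P -> (M < p + 50 * d)%N.

(** If a free [n < 2 * M] is a sum of two positive elements, one of them is below [M], hence in [P]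
    and above [M - 50 * d]. Either [n >= 2 * M - 50 * d], or the other summand is also in [P] and
    [n] is one of at most [K * K] sums. *)
Lemma card_gens_ge : (#|L| + #|O| <= #|gens G| + g + 56 * d)%N.
Proof.
pose PP : {set T} := [set (inord (x.1 + x.2) : T) | x : T * T in finset.setX P P].
have cPP : (#|PP| <= K * K)%N by rewrite (leq_trans (leq_imset_card _ _)) // cardsX (fp_K fp).
have : L :\: (G :\: O) \subset gens G :|: (L :\: middle) :|: PP :|:
    [set n : T | (2 * M - 50 * d <= n < 2 * M)%N].
  apply/subsetP => n /setDP[nL nGO]; rewrite !in_setU in_setD nL andbT.
  have [nm /=|//] := boolP (n \in middle); last by rewrite orbT.
  have [//|ngens /=] := boolP (n \in gens G); move: nm; rewrite !inE => /andP[Mn n2M].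
  rewrite n2M andbT; apply/orP; have [lt_n|_] := ltnP n (2 * M - 50 * d); [left|by right].
  have nG : n \notin G.
    apply: contra nGO => nG; rewrite inE nG andbT.
    by move: (subsetP free_undecided _ nL); rewrite inE => /and3P[].
  have n0 : (0 < n)%N by clia.
  move: ngens; rewrite inE n0 nG /= negbK => /existsP[a /existsP[b /and5P[a0 b0 aG bG /eqP ab]]].
  have inP (x : T) : (0 < x)%N -> x \notin G -> (x < M)%N -> x \in P.
    by move=> x0 xG xM; rewrite (fp_P fp) inE x0 xM.
  have both (x y : T) : (0 < x)%N -> x \notin G -> (0 < y)%N -> y \notin G -> (x < M)%N ->
      (x + y = n)%N -> n \in PP.
    move=> x0 xG y0 yG xM xy; have xP := inP _ x0 xG xM; have := Hp xP => xd.
    have yP : y \in P by apply: inP => //; lia.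
    apply/imsetP; exists (x, y); first by rewrite inE xP yP.
    by apply: val_inj; rewrite /= xy inordK ?ltn_ord.
  have [aM|aM] := ltnP a M; first exact: (both a b).
  by apply: (both b a) => //; [lia | rewrite addnC].
have GOL : G :\: O \subset L by apply/subsetP => n /setDP[nG nO]; exact: gaps_free.
move=> /subset_leq_card; rewrite cardsD (setIidPr GOL).
have := subset_leq_card GOL; have := out_le; rewrite gaps_out => ol le h.
have {h} := leq_trans h (leq_card_setU _ _).
rewrite card_ord_interval; last by have := fp_M fp; lia.
have := leq_of_leqif (leq_card_setU (gens G :|: (L :\: middle)) PP).
have := leq_of_leqif (leq_card_setU (gens G) (L :\: middle)).
have := card_free_high; clia.
Qed.

(** Count pairs [(n, p)] with [n + p] in [D]: each [n] has at least [K - t] of them and each [p] at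
    most [#|D|]. As [D] avoids both [G] and [L], it lies in [P] and the missing part of [middle], so
    [#|D| <= 7 * d]; [t >= 2] costs a factor 2. *)
Lemma card_pfs_low : (#|pfs G :&: below N M| <= 14 * d)%N.
Proof.
set v := _ :&: _.
have shift_lt (n : T) p : n \in v -> p \in P -> (n + p < N.+1)%N.
  by rewrite !inE => /andP[_ nM] /P_lt pM; have := fp_M fp; lia.
have sum_ge : (#|v| * (K - t) <= \sum_(n in v) \sum_(p in P | inord (n + p) \in D) 1)%N.
  rewrite -sum_nat_const; apply: leq_sum => n nv; rewrite sum1_card leq_subLR.
  have -> : K = #|P| by rewrite (fp_K fp).
  rewrite -(cardID (fun p : T => (inord (n + p) : T) \in D) P) addnC.
  apply: leq_add; last by rewrite leq_eqVlt; apply/orP; left; apply/eqP/eq_card => p; rewrite !inE andbC.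
  move: (nv); rewrite inE => /andP[npf]; rewrite inE => nM.
  apply: leq_trans (ltnW (fp_pfs fp npf nM)).
  rewrite -(card_in_imset (f := fun p : T => inord (n + p) : T)); last first.
    move=> p p' /andP[_ pP] /andP[_ pP'] /(congr1 val).
    rewrite /= !inordK ?shift_lt // => e; apply: val_inj => /=; lia.
  apply/subset_leq_card/subsetP => x /imsetP[p /andP[pD pP] ->].
  by rewrite in_setD pD; apply/imsetP; exists p.
have sum_le : (\sum_(n in v) \sum_(p in P | inord (n + p) \in D) 1 <= K * #|D|)%N.
  rewrite (exchange_big_dep (mem P)) /=; last by move=> n p _ /andP[].
  rewrite -(fp_K fp) -sum_nat_const; apply: leq_sum => p pP.
  rewrite sum1_card -(card_in_imset (f := fun n : T => inord (n + p) : T)); last first.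
    move=> n n' /andP[nv _] /andP[nv' _] /(congr1 val).
    rewrite /= !inordK ?shift_lt // => e; apply: val_inj => /=; lia.
  apply/subset_leq_card/subsetP => x /imsetP[n /andP[_ /andP[_ nD]] ->] //.
have D_le : (#|D| <= 7 * d)%N.
  have : D \subset P :|: (middle :\: L).
    apply/subsetP => x xD; have xG : x \notin G by rewrite (disjointFr (fp_in fp) xD).
    rewrite in_setU in_setD [x \in L]in_setD xD /=.
    have x_lt : (0 < x < 2 * M)%N.
      case/bigcupP: xD => n /(fp_V fp) nM /imsetP[p pP ->].
      rewrite inordK; first by have := P_pos pP; have := P_lt pP; clia.
      by have := P_lt pP; have := fp_M fp; clia.
    rewrite [x \in P](_ : _ = (x < M)%N); last by rewrite (fp_P fp) inE xG andbT; case/andP: x_lt => ->.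
    by rewrite inE; case/andP: x_lt => _ ->; case: ltnP.
  move=> /subset_leq_card /leq_trans /(_ (leq_card_setU _ _)); rewrite (fp_K fp).
  have := card_free_missing; clia.
have := leq_trans sum_ge sum_le; rewrite -[X in (K - X)%N]muln1 -mulnBr mulnCA -mulnA leq_pmul2l //.
move=> h; rewrite -(leq_pmul2l t0); apply: leq_trans (_ : 2 * (#|v| * (t - 1)) <= _)%N.
  by clear -t2; nia.
by clear -h D_le; nia.
Qed.

Lemma card_pfs_le : (#|pfs G| + #|O| <= g + 17 * d)%N.
Proof.
have : pfs G \subset (G :\: O) :|: (pfs G :&: below N M) :|: (O :\: below N M).
  apply/subsetP => n npf; rewrite !in_setU in_setI !in_setD npf /=.
  have -> : n \in G by move: npf; rewrite inE => /andP[].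
  by rewrite andbT; case: (n \in O); case: (n \in below N M).
move=> /subset_leq_card /leq_trans /(_ (leq_card_setU _ _)).
have := leq_of_leqif (leq_card_setU (G :\: O) (pfs G :&: below N M)).
have := card_pfs_low; have := card_forced_out_high; rewrite gaps_out; clia.
Qed.

Hypothesis Hf : forall n, n \in G -> (n < 2 * M + 50 * d)%N.

(** Positive elements of the semigroup exceed [M - 50 * d], so adding one to a gap from
    [M + 100 * d] on passes [2 * M + 50 * d], beyond all gaps. *)
Lemma card_pfs_ge : (g <= #|O| + #|pfs G| + 100 * d)%N.
Proof.
have : G :\: O \subset pfs G :|: [set n : T | (M <= n < M + 100 * d)%N].
  apply/subsetP => n /setDP[nG nO].
  have Mn : (M <= n)%N by apply: undecided_ge; apply: (subsetP free_undecided); exact: gaps_free.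
  rewrite !inE nG Mn /= orbC; have [//|nM /=] := ltnP n (M + 100 * d).
  apply/forall_inP => s /andP[s0 sG'].
  have sM : (M < s + 50 * d)%N.
    have [sM|] := ltnP s M; last by clia.
    by apply: Hp; rewrite (fp_P fp) inE s0 sM.
  have [nsN|] := ltnP (n + s) N.+1; last exact: in_compl_big.
  rewrite -[(n + s)%N]/(val (Ordinal nsN)) in_compl_ord; apply/negP => /Hf /=; clia.
move=> /subset_leq_card /leq_trans /(_ (leq_card_setU _ _)).
have [le|gt] := leqP (M + 100 * d) N.+1.
  rewrite card_ord_interval // gaps_out; clia.
have -> : [set n : T | (M <= n < M + 100 * d)%N] = [set n : T | (M <= n < N.+1)%N].
  by apply/setP => n; rewrite !inE; have := ltn_ord n; clia.
by rewrite card_ord_interval // gaps_out; clia.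
Qed.

End Structure.

Import Order.TTheory GRing.Theory Num.Theory.
Local Open Scope ring_scope.

(** * Weighted counts of subsets *)

Section SubsetWeights.
Variables (R : numDomainType) (T : finType).
Implicit Types (L X : {set T}) (F : pred {set T}) (x y : R).

Definition subset_weight x L F : R := \sum_(X : {set T} | (X \subset L) && F X) x ^+ #|X|.

Lemma subset_weight_split x b L F : b \in L ->
  subset_weight x L F = subset_weight x (L :\ b) F
    + x * subset_weight x (L :\ b) (fun X => F (b |: X)).
Proof.
move=> bL; rewrite /subset_weight (bigID (fun X => b \in X)) /= addrC; congr (_ + _).
  by apply: eq_bigl => X; rewrite subsetD1; case: (b \in X); rewrite ?andbT ?andbF.
rewrite big_distrr /= (reindex_onto (fun X => b |: X) (fun X => X :\ b)) /=; last first.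
  by move=> X /andP[_ bX]; rewrite setD1K.
apply: eq_big => [X|X /andP[_ /eqP bX]].
  rewrite subUset sub1set bL setU11 andbT /= subsetD1.
  have [bX|bX] := boolP (b \in X); last by rewrite setU1K // eqxx !andbT.
  rewrite andbF /=; apply/andP => -[_ /eqP XE].
  by move: bX; rewrite -XE setD11.
by rewrite cardsU1 -bX setD11 exprS bX.
Qed.

Lemma subset_weight_le x L F F' : 0 <= x ->
  (forall X, X \subset L -> F X -> F' X) -> subset_weight x L F <= subset_weight x L F'.
Proof.
move=> x0 FF'; rewrite /subset_weight [leRHS](bigID F) /=.
rewrite -[leLHS]addr0 lerD //; last by apply: sumr_ge0 => X _; exact: exprn_ge0.
rewrite le_eqVlt; apply/orP; left; apply/eqP; apply: eq_bigl => X.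
by have [XL|] //= := boolP (X \subset L); have [/(FF' _ XL) ->|] //= := boolP (F X); rewrite ?andbF.
Qed.

Lemma subset_weight_ge0 x L F : 0 <= x -> 0 <= subset_weight x L F.
Proof. by move=> x0; apply: sumr_ge0 => X _; exact: exprn_ge0. Qed.

Lemma subset_weightT x L : subset_weight x L xpredT = (1 + x) ^+ #|L|.
Proof.
have [n] := ubnP #|L|; elim: n => // n IH in L *; rewrite ltnS => Ln.
have [->|[b bL]] := set_0Vmem L.
  rewrite cards0 expr0 /subset_weight (big_pred1 set0) ?cards0 ?expr0 //.
  by move=> X; rewrite andbT subset0.
rewrite (subset_weight_split _ _ bL) IH; last by rewrite (cardsD1 b L) bL in Ln.
by rewrite [in RHS](cardsD1 b L) bL exprS mulrDl mul1r.
Qed.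

Lemma subset_weightT_le x L F : 0 <= x -> subset_weight x L F <= (1 + x) ^+ #|L|.
Proof. by move=> x0; rewrite -subset_weightT; exact: subset_weight_le. Qed.

End SubsetWeights.

(* One forbidden configuration removes the fraction [1 / (1 + z) ^ 2 = z ^ 2] or
   [z / (1 + z) ^ 2 = z ^ 3] of the weight of a pair, the latter being the smaller. *)
Lemma subset_weight_pairs (R : realFieldType) (T : finType) (z : R) (L B : {set T})
    (h : T -> T) (beta : bool) (F : pred {set T}) :
  0 < z -> z + z ^+ 2 = 1 ->
  {in B &, injective h} -> B \subset L -> h @: B \subset L -> [disjoint B & h @: B] ->
  (forall X, F X -> forall y, y \in B -> ~~ ((y \notin X) && ((h y \in X) == beta))) ->
  subset_weight z L F <= (1 + z) ^+ #|L| * (1 - z ^+ 3) ^+ #|B|.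
Proof.
move=> z0 zz; have z0' := ltW z0.
have z1 : z <= 1 by nra.
have z3 : 0 <= 1 - z ^+ 3 by rewrite subr_ge0 exprn_ile1.
have [n] := ubnP #|B|; elim: n => // n IH in L B F *; rewrite ltnS => Bn hI BL hBL dB HF.
have [B0|[b bB]] := set_0Vmem B.
  by rewrite B0 cards0 expr0 mulr1 subset_weightT_le.
pose L2 := (L :\ b) :\ h b; pose B' := B :\ b.
have bL : b \in L by exact: (subsetP BL).
have hB y : y \in B -> h y \in h @: B by move=> ?; apply: imset_f.
have nhB y : y \in B -> h y \notin B.
  by move=> yB; apply/negP => hyB; move/disjointFr: dB => /(_ _ hyB); rewrite hB.
have hbb : h b != b by apply: contraNneq (nhB _ bB) => ->.
have hbL : h b \in L :\ b by rewrite !inE hbb (subsetP hBL) // hB.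
have cL : #|L| = #|L2|.+2 by rewrite (cardsD1 b L) bL (cardsD1 (h b) (L :\ b)) hbL.
have cB : #|B| = #|B'|.+1 by rewrite (cardsD1 b B) bB.
pose W := (1 + z) ^+ #|L2| * (1 - z ^+ 3) ^+ #|B'|.
have W0 : 0 <= W by rewrite mulr_ge0 // exprn_ge0 // addr_ge0.
have bnd (G : {set T} -> {set T}) :
    (forall X y, y != b -> y != h b -> (y \in G X) = (y \in X)) ->
    subset_weight z L2 (fun X => F (G X)) <= W.
  move=> HG; have B'B y : y \in B' -> y \in B by rewrite inE => /andP[].
  have ne0 y : y \in B' -> y != b by rewrite !inE => /andP[].
  have ne1 y : y \in B' -> y != h b.
    by move=> /B'B yB; apply: contraTneq yB => ->; exact: nhB.
  have ne2 y : y \in B' -> h y != b.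
    by move=> /B'B /nhB; apply: contraNneq => ->.
  have ne3 y : y \in B' -> h y != h b.
    move=> yB'; apply/eqP => /hI; rewrite B'B // => /(_ isT bB) yb.
    by move: yB'; rewrite yb !inE eqxx.
  apply: IH => //.
  - by rewrite -ltnS -cB ltnS.
  - by move=> x y /B'B xB /B'B yB; exact: hI.
  - apply/subsetP => y yB'; rewrite !inE ne1 //= (subsetP BL) ?B'B // andbT.
    by move: yB'; rewrite !inE => /andP[].
  - apply/subsetP => _ /imsetP[y yB' ->]; rewrite !inE ne3 // ne2 //=.
    by rewrite (subsetP hBL) ?hB ?B'B.
  - by apply: disjointWl (subsetDl _ _) (disjointWr (imsetS _ (subsetDl _ _)) dB).
  - move=> X FX y yB'; have := HF _ FX y (B'B _ yB').
    by rewrite !HG; [| exact: ne2 | exact: ne3 | exact: ne0 | exact: ne1].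
(* The four traces on a pair weigh [1], [z], [z], [z^2]. The three allowed ones sum to
   [1 + z + z^2 = 2] if [beta = true] and to [2 * z + z^2 = 1 + z] otherwise. *)
have -> : (1 + z) ^+ #|L| * (1 - z ^+ 3) ^+ #|B| = 2%:R * W.
  rewrite cL cB 3!exprS /W.
  have -> : (1 + z) * ((1 + z) * (1 + z) ^+ #|L2|) * ((1 - z ^+ 3) * (1 - z ^+ 3) ^+ #|B'|)
     = ((1 + z) ^+ 2 * (1 - z ^+ 3)) * ((1 + z) ^+ #|L2| * (1 - z ^+ 3) ^+ #|B'|) by ring.
  congr (_ * _).
  have z2 : z ^+ 2 = 1 - z by lra.
  have -> : z ^+ 3 = 2 * z - 1 by rewrite exprS z2 mulrBr mulr1 -expr2 z2; ring.
  rewrite sqrrD z2; have -> : (1 ^+ 2 + 1 * z *+ 2 + (1 - z)) * (1 - (2 * z - 1)) = 4 - 2 * z - 2 * z ^+ 2 by ring.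
  by rewrite z2; ring.
rewrite (subset_weight_split _ _ bL) !(subset_weight_split _ _ hbL) -/L2.
have w1 : subset_weight z L2 F <= W by apply: (bnd id).
have w2 : subset_weight z L2 (fun X => F (h b |: X)) <= W.
  by apply: (bnd (fun X => h b |: X)) => X y _ /negPf; rewrite !inE => ->.
have w3 : subset_weight z L2 (fun X => F (b |: X)) <= W.
  by apply: (bnd (fun X => b |: X)) => X y /negPf; rewrite !inE => ->.
have w4 : subset_weight z L2 (fun X => F (b |: (h b |: X))) <= W.
  by apply: (bnd (fun X => b |: (h b |: X))) => X y /negPf + /negPf; rewrite !inE => -> ->.
have nX (X : {set T}) : X \subset L2 -> [/\ b \notin X & h b \notin X].
  by rewrite !subsetD1 => /andP[/andP[_ ->] ->].
have zero (G : {set T} -> {set T}) : (forall X : {set T}, X \subset L2 -> ~~ F (G X)) -> subset_weight z L2 (fun X => F (G X)) = 0.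
  by move=> HG; apply: big1 => X /andP[/HG/negPf ->].
have [bt|bt] : beta = true \/ beta = false by case: (beta); [left|right].
- have -> : subset_weight z L2 (fun X => F (h b |: X)) = 0.
    apply: (zero (fun X => h b |: X)) => X /nX [bX hX]; apply/negP => /HF /(_ b bB).
    by rewrite !inE eqxx bt eq_sym (negPf hbb) (negPf bX).
  by nra.
- have -> : subset_weight z L2 F = 0.
    apply: (zero id) => X /nX [bX hX]; apply/negP => /HF /(_ b bB).
    by rewrite bt (negPf bX) (negPf hX).
  by nra.
Qed.

(** Each such [Q] contributes at least [y ^ k] to the total weight [(1 + y) ^ #|T|] of all
    subsets. *)
Lemma card_small_sets (R : realFieldType) (T : finType) (y : R) (k : nat) :
  0 < y -> y <= 1 ->
  (#|[set Q : {set T} | (#|Q| <= k)%N]|)%:R <= y ^- k * (1 + y) ^+ #|T|.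
Proof.
move=> y0 y1; rewrite -ler_pdivrMl ?invr_gt0 ?exprn_gt0 // invrK -cardsT -subset_weightT.
rewrite /subset_weight -sum1_card natr_sum big_distrr /=.
under [leRHS]eq_bigl do rewrite subsetT.
rewrite [leRHS](bigID (fun Q : {set T} => (#|Q| <= k)%N)) /=.
rewrite -[leLHS]addr0 lerD //; last by apply: sumr_ge0 => Q _; rewrite exprn_ge0 // ltW.
under [leLHS]eq_bigl do rewrite inE.
apply: ler_sum => Q Qk; rewrite mulr1 ler_wiXn2l //; exact: ltW.
Qed.

Lemma expR_pow_le (R : realType) (x a : R) (n : nat) :
  0 <= x -> x <= expR a -> x ^+ n <= expR (n%:R * a).
Proof.
move=> x0 xa; apply: le_trans (lerXn2r n _ _ xa) _; rewrite ?nnegrE ?expR_ge0 //.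
by rewrite -expRM_natl.
Qed.

(* Chernoff's argument: replace the weight [z] by [z * (1 + h)]. *)
Lemma subset_weight_tilt (R : realType) (T : finType) (z h : R) (L : {set T}) (k : nat) :
  0 < z -> z + z ^+ 2 = 1 -> - 2^-1 <= h ->
  subset_weight z L (fun X => #|X| == k)
    <= (1 + z) ^+ #|L| * expR (h * (z ^+ 2 * #|L|%:R - k%:R) + 2 * h ^+ 2 * k%:R).
Proof.
move=> z0 zz hh; have w0 : 0 < 1 + h by lra.
have -> : subset_weight z L (fun X => #|X| == k)
    = ((1 + h)^-1) ^+ k * subset_weight (z * (1 + h)) L (fun X => #|X| == k).
  rewrite /subset_weight big_distrr /=; apply: eq_bigr => X /andP[_ /eqP ->].
  by rewrite -exprMn mulrCA mulVf ?mulr1 // gt_eqF.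
have e1 : ((1 + h)^-1) ^+ k <= expR (k%:R * (- h + 2 * h ^+ 2)).
  apply: expR_pow_le; first by rewrite invr_ge0 ltW.
  apply: le_trans (expR_ge1Dx _); rewrite -[leLHS]mul1r ler_pdivrMr //; nra.
(* An element is present with probability [z / (1 + z) = z^2], the mean density. *)
have e2 : 1 + z * (1 + h) <= (1 + z) * expR (z ^+ 2 * h).
  have -> : 1 + z * (1 + h) = (1 + z) * (1 + z ^+ 2 * h).
    have z2 : z ^+ 2 = 1 - z by lra.
    have z3 : z * z ^+ 2 = 2 * z - 1 by rewrite z2 mulrBr mulr1 -expr2 z2; ring.
    transitivity (1 + z + h * (z ^+ 2 + z * z ^+ 2)); last by ring.
    by rewrite z3 z2; ring.
  by rewrite ler_wpM2l ?expR_ge1Dx //; lra.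
have e3 : (1 + z * (1 + h)) ^+ #|L| <= (1 + z) ^+ #|L| * expR (#|L|%:R * (z ^+ 2 * h)).
  rewrite expRM_natl -exprMn; apply: lerXn2r => //; rewrite nnegrE.
    by apply: addr_ge0 => //; apply: mulr_ge0; apply: ltW.
  by apply: mulr_ge0; [lra | exact: expR_ge0].
apply: le_trans (ler_pM _ _ e1 (le_trans (subset_weightT_le _ _ _) e3)) _.
- by apply: exprn_ge0; rewrite invr_ge0 ltW.
- by apply: subset_weight_ge0; apply: mulr_ge0; exact: ltW.
- by apply: mulr_ge0; exact: ltW.
rewrite mulrCA -expRD.
by have -> : k%:R * (- h + 2 * h ^+ 2) + #|L|%:R * (z ^+ 2 * h) =
   h * (z ^+ 2 * #|L|%:R - k%:R) + 2 * h ^+ 2 * k%:R by ring.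
Qed.

(** Tilt by [h = D / (4 * g)] in absolute value, with sign opposite to the deviation; [D <= 2 * g]
    keeps [h] within the range of [subset_weight_tilt]. *)
Lemma subset_weight_deviation (R : realType) (T : finType) (z D : R) (L : {set T}) (k g : nat) :
  0 < z -> z + z ^+ 2 = 1 -> (0 < g)%N -> (k <= g)%N -> 0 <= D -> D <= 2 * g%:R ->
  D <= `|z ^+ 2 * #|L|%:R - k%:R| ->
  subset_weight z L (fun X => #|X| == k) <= (1 + z) ^+ #|L| * expR (- (D ^+ 2 / (8 * g%:R))).
Proof.
move=> z0 zz g0 kg D0 Dg; set x := _ - _ => Dx.
have g0' : 0 < g%:R :> R by rewrite ltr0n.
have kg' : k%:R <= g%:R :> R by rewrite ler_nat.
pose a := D / (4 * g%:R).
have a0 : 0 <= a by apply: divr_ge0 => //; lra.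
have a1 : a <= 2^-1 by rewrite ler_pdivrMr; lra.
have Da : D = a * (4 * g%:R) by rewrite /a divfK //; apply: lt0r_neq0; lra.
have -> : D ^+ 2 / (8 * g%:R) = 2 * a ^+ 2 * g%:R.
  by rewrite Da; field; apply: lt0r_neq0.
have [h [h1 hx h2]] : exists h : R, [/\ - 2^-1 <= h, h * x <= - a * D & h ^+ 2 = a ^+ 2].
  have [x0|x0] := lerP 0 x.
    by exists (- a); rewrite ger0_norm // in Dx; split; [lra | nra | rewrite sqrrN].
  by exists a; rewrite ltr0_norm // in Dx; split; [lra | nra | ].
apply: le_trans (subset_weight_tilt _ _ z0 zz h1) _.
apply: ler_wpM2l; first by apply: exprn_ge0; lra.
rewrite ler_expR h2 -/x.
have : 2 * a ^+ 2 * k%:R <= 2 * a ^+ 2 * g%:R by apply: ler_wpM2l => //; nra.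
by rewrite Da in hx; nra.
Qed.

(** Pascal's rule, termwise on the diagonal sums of the triangle, which are the Fibonacci
    numbers. *)
Lemma sum_bin_fib n : (\sum_(j < n.+3) 'C(j, n.+2 - j) =
  \sum_(j < n.+2) 'C(j, n.+1 - j) + \sum_(j < n.+1) 'C(j, n - j))%N.
Proof.
rewrite big_ord_recl /= bin0n add0n big_ord_recr /= subnn bin0.
rewrite [in RHS]big_ord_recr /= subnn bin0 [in RHS]addnAC; congr (_ + _)%N.
rewrite -big_split /=; apply: eq_bigr => j _.
by rewrite /bump /= add1n subSS subSn ?binS // -ltnS.
Qed.

(** The powers [z ^- n] satisfy the same recurrence because [z + z ^ 2 = 1]. *)
Lemma sum_bin_ge (R : realFieldType) (z : R) (n : nat) : 0 < z -> z + z ^+ 2 = 1 ->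
  z ^- n * z <= (\sum_(j < n.+1) 'C(j, n - j))%:R.
Proof.
move=> z0 zz; have z1 : z <= 1 by nra.
suff: z ^- n * z <= (\sum_(j < n.+1) 'C(j, n - j))%:R /\
  z ^- n.+1 * z <= (\sum_(j < n.+2) 'C(j, n.+1 - j))%:R by case.
elim: n => [|n [IH1 IH2]].
  by rewrite !big_ord_recl !big_ord0 /= expr0 invr1 mul1r expr1 mulVf ?gt_eqF.
split=> //; rewrite sum_bin_fib natrD; apply: le_trans (lerD IH2 IH1).
rewrite le_eqVlt; apply/orP; left; apply/eqP.
by rewrite !exprS -[LHS]mulr1 -zz; field; rewrite expf_neq0 // gt_eqF.
Qed.

(** * Semigroups with a given fingerprint *)

(** [G] is recovered from [G :\: A], and [x ^ g] splits into the weights of [A] and of [G :\: A]. *)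
Lemma card_extensions (R : numDomainType) (T : finType) (x : R) (A L : {set T})
    (F : {set {set T}}) (p : pred {set T}) (g : nat) : 0 <= x ->
  (forall G, G \in F -> [/\ A \subset G, G \subset A :|: L, #|G| = g & p (G :\: A)]) ->
  #|F|%:R * x ^+ g <= x ^+ #|A| * subset_weight x L p.
Proof.
move=> x0 HF; rewrite -[#|F|%:R]mulr1 mulr_natl -sumr_const mulr_suml.
have -> : \sum_(G in F) 1 * x ^+ g = x ^+ #|A| * \sum_(G in F) x ^+ #|G :\: A|.
  rewrite mulr_sumr; apply: eq_bigr => G /HF [AG _ <- _].
  by rewrite mul1r cardsD (setIidPr AG) -exprD subnKC // subset_leq_card.
apply: ler_wpM2l; first exact: exprn_ge0.
have inj : {in F &, injective (fun G => G :\: A)}.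
  move=> G H /HF [AG _ _ _] /HF [AH _ _ _] e.
  by rewrite -(setID G A) -(setID H A) (setIidPr AG) (setIidPr AH) e.
rewrite -(big_imset (fun X : {set T} => x ^+ #|X|) inj) /subset_weight /=.
rewrite [leRHS](bigID (mem [set G :\: A | G in F])) /= -[leLHS]addr0 lerD //; last first.
  by apply: sumr_ge0 => X _; exact: exprn_ge0.
rewrite le_eqVlt; apply/orP; left; apply/eqP; apply: eq_bigl => X.
have [/imsetP[G /HF [_ GAL _ pG] ->]|] := boolP (X \in [set G :\: A | G in F]); last by rewrite andbF.
by rewrite pG subDset GAL.
Qed.

Lemma golden_bounds (R : realType) (z : R) : 0 < z -> z + z ^+ 2 = 1 ->
  6 / 10 < z /\ z < 62 / 100 /\ 615 / 1000 < z.
Proof.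
move=> z0 zz; have z2 : z * z = 1 - z by rewrite -expr2; lra.
have sq (a b : R) : 0 <= a -> a <= b -> a * a <= b * b by move=> a0 ab; exact: ler_pM.
split; [|split]; rewrite ltNge; apply/negP => h.
- by have := sq _ _ (ltW z0) h; rewrite z2; lra.
- have c0 : 0 <= 62 / 100 :> R by lra.
  by have := sq _ _ c0 h; rewrite z2; lra.
- by have := sq _ _ (ltW z0) h; rewrite z2; lra.
Qed.

Lemma density_bounds (R : realType) (z gam : R) : 0 < z -> z + z ^+ 2 = 1 ->
  gam * (1 + z ^+ 2) = 1 -> 72 / 100 <= gam /\ gam <= 1.
Proof.
move=> z0 zz gamE; have [b1 [b2 b3]] := golden_bounds z0 zz.
have z2 : z ^+ 2 = 1 - z by lra.
by rewrite z2 in gamE; split; nra.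
Qed.

(** With [l] close to [o], the deviation bound makes [(1 + z ^ 2) * o] close to [g], so [o] is close
    to [gam * g]. *)
Lemma outside_bounds (R : realType) (z gam o l g d D : R) : 0 < z -> z + z ^+ 2 = 1 ->
  gam * (1 + z ^+ 2) = 1 -> 0 <= D -> 0 <= d -> o <= l + d -> l <= o + 2 * d ->
  - D < z ^+ 2 * l - (g - o) -> z ^+ 2 * l - (g - o) < D ->
  o <= gam * g + D + d /\ gam * g - D - 2 * d <= o.
Proof.
move=> z0 zz gamE D0 d0 ol lo HD1 HD2.
have [b1 [b2 b3]] := golden_bounds z0 zz; have [gb1 gb2] := density_bounds z0 zz gamE.
have w0 : 0 <= z ^+ 2 by apply: exprn_ge0; exact: ltW.
have wd : z ^+ 2 * d <= d by rewrite ler_piMl //; lra.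
have wl : z ^+ 2 * l <= z ^+ 2 * (o + 2 * d) by apply: ler_wpM2l.
have wo : z ^+ 2 * o <= z ^+ 2 * (l + d) by apply: ler_wpM2l.
have gam0 : 0 <= gam by lra.
have gam_le x : 0 <= x -> gam * x <= x by move=> x0; rewrite ler_piMl.
have oE : gam * ((1 + z ^+ 2) * o) = o by rewrite mulrA gamE mul1r.
split; rewrite -{1}oE.
  apply: le_trans (_ : gam * (g + (D + d)) <= _); first by apply: ler_wpM2l => //; lra.
  by have := gam_le (D + d); rewrite mulrDr; lra.
apply: le_trans (_ : gam * (g - (D + 2 * d)) <= _).
  by have := gam_le (D + 2 * d); rewrite mulrBr; lra.
by apply: ler_wpM2l => //; lra.
Qed.

Lemma typical_bounds (R : realType) (gam eps o l M e p g d D : R) :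
  0 <= D -> 0 <= d -> 2 * D + 101 * d < eps * g ->
  o <= gam * g + D + d -> gam * g - D - 2 * d <= o ->
  o <= l + d -> l <= o + 2 * d -> M <= o + d ->
  e + g <= M + o + 2 * d -> l + o <= e + g + 56 * d ->
  p + o <= g + 17 * d -> g <= o + p + 100 * d ->
  `|e - (2 * gam - 1) * g| < eps * g /\ `|p - (1 - gam) * g| < eps * g.
Proof.
move=> *; rewrite !ltr_norml !mulrBl mul1r -mulrA.
by split; apply/andP; split; lra.
Qed.

(** Since [z * (1 + z) = 1], only [(1 + z) ^ (2 * d)] remains, and [z < 62 / 100]. *)
Lemma golden_weight_le (R : realType) (z : R) (o l d : nat) : 0 < z -> z + z ^+ 2 = 1 -> (l <= o + 2 * d)%N ->
  z ^+ o * (1 + z) ^+ l <= expR (d%:R * (124 / 100)).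
Proof.
move=> z0 zz lo; have [b1 [b2 _]] := golden_bounds z0 zz.
have e : z * (1 + z) = 1 by rewrite mulrDr mulr1 -expr2.
apply: le_trans (_ : z ^+ o * (1 + z) ^+ (o + 2 * d) <= _).
  apply: ler_wpM2l; first by apply: exprn_ge0; exact: ltW.
  by apply: ler_weXn2l => //; lra.
rewrite exprD mulrA -exprMn e expr1n mul1r exprM.
apply: expR_pow_le; first by apply: exprn_ge0; lra.
have -> : 124 / 100 = 2%:R * (62 / 100) :> R by lra.
apply: expR_pow_le; first by lra.
by apply: le_trans (expR_ge1Dx _); lra.
Qed.

Lemma golden_pairs_le (R : realType) (z : R) (o l d b : nat) :
  0 < z -> z + z ^+ 2 = 1 -> (l <= o + 2 * d)%N -> (10 * d <= b)%N ->
  z ^+ o * ((1 + z) ^+ l * (1 - z ^+ 3) ^+ b) <= expR (- (d%:R / 4)).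
Proof.
move=> z0 zz lo db; have [b1 [b2 b3]] := golden_bounds z0 zz.
have z3E : z ^+ 3 = 2 * z - 1.
  have z2 : z ^+ 2 = 1 - z by lra.
  by rewrite exprS z2 mulrBr mulr1 -expr2; lra.
have c0 : 0 <= 1 - z ^+ 3 by lra.
(* [1 - z^3 = 2 - 2 * z < 77 / 100] gives [23 / 100] per pair; the resulting [23 / 10] exceeds
   [124 / 100 + 1 / 4]. *)
have c1 : (1 - z ^+ 3) ^+ b <= expR (d%:R * (- (23 / 10))).
  apply: le_trans (_ : (1 - z ^+ 3) ^+ (10 * d) <= _); first by apply: ler_wiXn2l => //; lra.
  rewrite exprM; apply: expR_pow_le; first exact: exprn_ge0.
  have -> : - (23 / 10) = 10%:R * (- (23 / 100)) :> R by lra.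
  apply: expR_pow_le => //; apply: le_trans (expR_ge1Dx _); lra.
rewrite mulrA; apply: le_trans (ler_pM _ _ (golden_weight_le z0 zz lo) c1) _.
- by rewrite mulr_ge0 ?exprn_ge0 //; lra.
- exact: exprn_ge0.
rewrite -expRD ler_expR; have : 0 <= d%:R :> R by []. lra.
Qed.

Lemma leq_card_bigcup (I T : finType) (p : pred I) (A : I -> {set T}) :
  (#|\bigcup_(i | p i) A i| <= \sum_(i | p i) #|A i|)%N.
Proof.
elim/big_rec2: _ => [|i n B _ IH]; first by rewrite cards0.
by rewrite (leq_trans (leq_card_setU _ _)) // leq_add2l.
Qed.

Section TemplateBound.
Variables (R : realType) (N t d g : nat) (z eps D gam : R).
Local Notation T := 'I_N.+1.
Local Notation K := (t * t)%N.

Definition near_typical (G : {set T}) : Prop :=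
  `| #|gens G|%:R - (2 * gam - 1) * g%:R | < eps * g%:R /\
  `| #|pfs G|%:R - (1 - gam) * g%:R | < eps * g%:R.

(* [d] is the scale of the errors made in describing [G] by its fingerprint, [D] the
   larger scale of the fluctuations allowed for the number of gaps in [free]. *)
Record scales : Prop := Scales {
  sc_z : 0 < z /\ z + z ^+ 2 = 1;
  sc_gam : gam * (1 + z ^+ 2) = 1;
  sc_g : (0 < g)%N;
  sc_N : (4 * g <= N)%N;
  sc_t : (2 <= t)%N;
  sc_td : (N.+1 <= t * d)%N;
  sc_K : (K * K + K + 1 <= d)%N;
  sc_D : 0 <= D;
  sc_Dd : 12 * g%:R * d%:R <= D ^+ 2;
  sc_eps : 2 * D + 101 * d%:R < eps * g%:R;
  sc_Dg : D + 4 * d%:R <= g%:R / 20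
}.

(** The first conclusion puts all gaps below [3 * M], the range of [reflect_pairs]: [M] is at least
    about [gam * g], and [72 / 100 - 1 / 20 > 2 / 3]. *)
Lemma near_typicalP M (P Q V G : {set T}) :
  let O := forced_out M P Q in let L := free t M P Q V in
  scales -> gap_set G -> #|G| = g -> fingerprint t K g M P Q V G ->
  (#|O| < #|L| + d)%N -> `|z ^+ 2 * #|L|%:R - (g - #|O|)%:R| < D ->
  (forall p, p \in P -> (M < p + 50 * d)%N) ->
  (2 * g < 3 * M)%N /\
  ((forall n, n \in G -> (n < 2 * M + 50 * d)%N) -> near_typical G).
Proof.
move=> O L [[z0 zz] gamE g0 gN t2 Nd Kd D0 Dd Deps Dg] sG Gg fp Hl HD Hp.
have [b1 [b2 b3]] := golden_bounds z0 zz.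
have [gb1 gb2] := density_bounds z0 zz gamE.
have og : (#|O| <= g)%N by rewrite -Gg; apply/subset_leq_card/(fp_out fp).
have lo : (#|L| <= #|O| + 2 * d)%N by exact: (card_free_le sG Gg gN t2 Nd Kd fp).
have Mo : (M <= #|O| + d)%N by exact: (card_forced_out_ge Gg gN t2 Nd Kd fp).
have lu : (#|L| <= M + d)%N.
  apply: leq_trans (card_undecided sG Gg gN t2 Nd Kd fp).
  by apply/subset_leq_card/subsetDl.
have oM : (#|O| < M + 2 * d)%N.
  by rewrite (leq_trans Hl) // mul2n -addnn addnA leq_add2r.
have e1 := card_gens_le sG Gg gN t2 Nd Kd fp Hl.
have e2 := card_gens_ge sG Gg gN t2 Nd Kd fp Hl Hp.
have p1 := card_pfs_le sG Gg gN t2 Nd Kd fp Hl.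
have p2 := fun Hf => card_pfs_ge sG Gg gN t2 Nd Kd fp Hl Hp Hf.
rewrite -/O -/L in e1 e2 p1 p2 Hl.
move: HD; rewrite natrB // ltr_norml => /andP[HD1 HD2].
have lo' : #|L|%:R <= #|O|%:R + 2 * d%:R :> R by rewrite -natrM -natrD ler_nat.
have Mo' : M%:R <= #|O|%:R + d%:R :> R by rewrite -natrD ler_nat.
have oM' : #|O|%:R < M%:R + 2 * d%:R :> R by rewrite -natrM -natrD ltr_nat.
have Hl' : #|O|%:R < #|L|%:R + d%:R :> R by rewrite -natrD ltr_nat.
have d0 : 0 <= d%:R :> R by [].
have [o1 o2] := outside_bounds z0 zz gamE D0 d0 (ltW Hl') lo' HD1 HD2.
split.
  have g1 : 1 <= g%:R :> R by rewrite ler1n.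
  have gg : 72 / 100 * g%:R <= gam * g%:R by apply: ler_wpM2r.
  by rewrite -(ltr_nat R) !natrM; move: o2 oM' gg Dg g1; clear; lra.
move=> Hf; have := p2 Hf => {}p2.
have e1' : #|gens G|%:R + g%:R <= M%:R + #|O|%:R + 2 * d%:R :> R.
  by rewrite -natrM -!natrD ler_nat.
have e2' : #|L|%:R + #|O|%:R <= #|gens G|%:R + g%:R + 56 * d%:R :> R.
  by rewrite -natrM -!natrD ler_nat.
have p1' : #|pfs G|%:R + #|O|%:R <= g%:R + 17 * d%:R :> R.
  by rewrite -natrM -!natrD ler_nat.
have p2' : g%:R <= #|O|%:R + #|pfs G|%:R + 100 * d%:R :> R.
  by rewrite -natrM -!natrD ler_nat.
exact: typical_bounds D0 d0 Deps o1 o2 (ltW Hl') lo' Mo' e1' e2' p1' p2'.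
Qed.

Lemma template_bound M (P Q V : {set T}) (F : {set {set T}}) : scales ->
  (forall G, G \in F -> [/\ gap_set G, #|G| = g, fingerprint t K g M P Q V G
     & ~ near_typical G]) ->
  #|F|%:R * z ^+ g <= N.+1%:R * expR (- (d%:R / 4)).
Proof.
move=> sc; have [[z0 zz] gamE g0 gN t2 Nd Kd D0 Dd Deps Dg] := sc; move=> HF.
have [->|[G0 G0F]] := set_0Vmem F.
  by rewrite cards0 mul0r mulr_ge0 ?expR_ge0.
have [b1 [b2 b3]] := golden_bounds z0 zz; have z0' := ltW z0.
have d0 : 0 <= d%:R :> R by [].
have [sG0 Gg0 fp0 _] := HF _ G0F.
set O := forced_out M P Q; set L := free t M P Q V.
have FO G : G \in F -> [/\ O \subset G, G \subset O :|: L & #|G| = g].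
  by move=> /HF [_ Gg fp _]; split; rewrite ?(fp_out fp) ?(fp_gaps fp).
have lo : (#|L| <= #|O| + 2 * d)%N by exact: (card_free_le sG0 Gg0 gN t2 Nd Kd fp0).
have og : (#|O| <= g)%N by rewrite -Gg0; apply/subset_leq_card/(fp_out fp0).
suff : #|F|%:R * z ^+ g <= expR (- (d%:R / 4)) \/ #|F|%:R * z ^+ g <= N.+1%:R * expR (- (d%:R / 4)).
  case=> // /le_trans; apply; apply: ler_peMl; first exact: expR_ge0.
  by rewrite ler1n.
have [case1|Hl] := leqP (#|L| + d) #|O|.
  left; apply: le_trans (card_extensions (p := xpredT) (g := g) (A := O) (L := L) z0' _) _.
    by move=> G /FO [].
  rewrite subset_weightT -(subnK case1) addnCA exprD.
  have e : z * (1 + z) = 1 by rewrite mulrDr mulr1 -expr2.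
  rewrite mulrAC -exprMn e expr1n mul1r.
  apply: le_trans (_ : z ^+ d <= _); first by apply: ler_wiXn2l; [by []|lra|exact: leq_addl].
  have -> : - (d%:R / 4) = d%:R * (- (1 / 4)) :> R by lra.
  by apply: expR_pow_le => //; apply: le_trans (expR_ge1Dx _); lra.
have LO y : y \in L -> y \notin O.
  by move=> /setDP[+ _]; rewrite in_set => /and3P[].
have [case2|HD] := lerP D `|z ^+ 2 * #|L|%:R - (g - #|O|)%:R|.
  left; apply: le_trans (card_extensions (p := fun X => #|X| == (g - #|O|)%N) (g := g) (A := O) (L := L) z0' _) _.
    by move=> G /FO [OG GOL Gg]; split=> //; rewrite cardsD (setIidPr OG) Gg.
  apply: le_trans (ler_wpM2l (exprn_ge0 _ z0') (subset_weight_deviation z0 zz g0 (leq_subr _ _) D0 _ case2)) _.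
    lra.
  rewrite mulrA; apply: le_trans (ler_wpM2r (expR_ge0 _) (golden_weight_le z0 zz lo)) _.
  rewrite -expRD ler_expR.
  (* This is where the 12 in [sc_Dd] comes from: [12 / 8] exceeds [124 / 100 + 1 / 4]. *)
  have : 3 / 2 * d%:R <= D ^+ 2 / (8 * g%:R).
    by rewrite ler_pdivlMr; [lra | rewrite mulr_gt0 // ltr0n].
  lra.
have [/existsP[p /andP[pP pM]]|/existsPn Hp] := boolP [exists p : T, (p \in P) && (p + 50 * d <= M)%N].
  left; have [B [h [[hI BL hBL dB cB] hE]]] := shift_pairs sG0 Gg0 gN t2 Nd Kd fp0 Hl pP pM.
  pose ok (X : {set T}) := [forall y in B, ~~ ((y \notin X) && ((h y \in X) == true))].
  apply: le_trans (card_extensions (p := ok) (g := g) (A := O) (L := L) z0' _) _.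
    move=> G GF; have [sG Gg fp _] := HF _ GF; have [OG GOL _] := FO _ GF; split=> //.
    apply/forall_inP => y yB; rewrite eqb_id; apply/negP => /andP[].
    have yO := LO _ (subsetP BL _ yB).
    rewrite in_setD yO /= => yG /setDP[hyG _]; move/negP: hyG; apply; apply/negP.
    rewrite -in_compl_ord hE //; case: sG => _; apply; rewrite in_compl_ord //.
    by move: pP; rewrite (fp_P fp) inE => /and3P[].
  apply: le_trans (ler_wpM2l (exprn_ge0 _ z0') (subset_weight_pairs (F := ok) (beta := true) z0 zz hI BL hBL dB _)) _.
    by move=> X /forall_inP H y yB; exact: H.
  exact: golden_pairs_le.
have Hp' p : p \in P -> (M < p + 50 * d)%N.
  by move=> pP; have := Hp p; rewrite pP /= -ltnNge.
(* The earlier cases depend on the fingerprint only. Now each [G] has its own gap beyond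
   [2 * M + 50 * d], and a union bound over this gap costs the factor [N + 1]. *)
right; have [M3 _] := near_typicalP sc sG0 Gg0 fp0 Hl HD Hp'.
pose Fn (n : T) := [set G in F | n \in G].
have FFn : F \subset \bigcup_(n : T | (2 * M + 50 * d <= n)%N) Fn n.
  apply/subsetP => G GF; have [sG Gg fp nt] := HF _ GF.
  have [_ H] := near_typicalP sc sG Gg fp Hl HD Hp'.
  apply: contrapT => nG; apply: nt; apply: H => n nG'; rewrite ltnNge; apply/negP => Mn.
  by apply: nG; apply/bigcupP; exists n => //; rewrite inE GF.
have FnE (n : T) : (2 * M + 50 * d <= n)%N -> #|Fn n|%:R * z ^+ g <= expR (- (d%:R / 4)).
  move=> Mn; have [->|[G1]] := set_0Vmem (Fn n).
    by rewrite cards0 mul0r expR_ge0.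
  rewrite inE => /andP[/HF [sG1 Gg1 _ _] nG1].
  have nM : (n < 3 * M)%N by rewrite (leq_trans (gap_lt_double sG1 nG1)) // Gg1 ltnW.
  have [B [h [[hI BL hBL dB cB] hE]]] := reflect_pairs sG0 Gg0 gN t2 Nd Kd fp0 Hl Mn nM.
  pose ok (X : {set T}) := [forall y in B, ~~ ((y \notin X) && ((h y \in X) == false))].
  apply: le_trans (card_extensions (p := ok) (g := g) (A := O) (L := L) z0' _) _.
    move=> G /setIdP[GF nG]; have [sG Gg fp _] := HF _ GF; have [OG GOL _] := FO _ GF; split=> //.
    apply/forall_inP => y yB; rewrite eqbF_neg; apply/negP => /andP[].
    have yO := LO _ (subsetP BL _ yB).
    have hyO := LO _ (subsetP hBL _ (imset_f h yB)).
    rewrite !in_setD yO hyO /= => yG hyG; move/negP: nG; apply; apply/negP.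
    by rewrite -in_compl_ord -(hE _ yB); case: sG => _; apply; rewrite in_compl_ord.
  apply: le_trans (ler_wpM2l (exprn_ge0 _ z0') (subset_weight_pairs (F := ok) (beta := false) z0 zz hI BL hBL dB _)) _.
    by move=> X /forall_inP H y yB; exact: H.
  exact: golden_pairs_le.
have cF : (#|F| <= \sum_(n : T | (2 * M + 50 * d <= n)%N) #|Fn n|)%N.
  exact: leq_trans (subset_leq_card FFn) (leq_card_bigcup _ _).
apply: le_trans (_ : (\sum_(n : T | (2 * M + 50 * d <= n)%N) #|Fn n|)%:R * z ^+ g <= _).
  by apply: ler_wpM2r; rewrite ?exprn_ge0 // ler_nat.
rewrite natr_sum mulr_suml; apply: le_trans (ler_sum _ FnE) _.
rewrite sumr_const -[leLHS]mulr_natl; apply: ler_wpM2r; first exact: expR_ge0.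
by rewrite ler_nat -[leqRHS]card_ord max_card.
Qed.

End TemplateBound.

(** * Summation over fingerprints *)

Definition gap_sets (N g : nat) : {set {set 'I_N.+1}} :=
  [set G : {set 'I_N.+1} | `[< gap_set G >] && (#|G| == g)].

(** Take the gaps [1..j] and any [g - j] numbers among [j + 2..2 * j + 1]: two positive non-gaps sum
    to at least [2 * j + 2], beyond all gaps. *)
Lemma card_gap_sets_ge_bin (N g j : nat) : (0 < g)%N -> (4 * g <= N)%N -> (j <= g)%N ->
  ('C(j, g - j) <= #|gap_sets N g|)%N.
Proof.
move=> g0 gN jg; pose T := 'I_N.+1.
pose A := [set n : T | (1 <= n < j.+1)%N]; pose B := [set n : T | (j.+2 <= n < (2 * j).+2)%N].
have cA : #|A| = j by rewrite card_ord_interval; lia.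
have cB : #|B| = j by rewrite card_ord_interval; lia.
have dAB : A :&: B = set0 by apply/setP => n; rewrite !inE; lia.
rewrite -[X in 'C(X, _)]cB -cards_draws.
have inj : {in [set X : {set T} | (X \subset B) & #|X| == (g - j)%N] &, injective (fun X => A :|: X)}.
  have AX (X : {set T}) : X \subset B -> (A :|: X) :\: A = X.
    move=> XB; rewrite setDUl setDv set0U; apply/setDidPl; rewrite -setI_eq0 -subset0 -dAB setIC.
    exact: setIS.
  by move=> X Y /setIdP[XB _] /setIdP[YB _] e; rewrite -(AX X XB) -(AX Y YB) e.
rewrite -(card_in_imset inj); apply/subset_leq_card/subsetP => G /imsetP[X /setIdP[XB /eqP cX] ->].
rewrite inE cardsU cA cX (_ : A :&: X = set0) ?cards0; last first.
  by apply/eqP; rewrite -subset0 -dAB setIS.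
rewrite subn0 subnKC // eqxx andbT; apply/asboolP.
have hi (n : T) : n \in A :|: X -> (0 < n < (2 * j).+2)%N.
  by rewrite inE => /orP[|/(subsetP XB)]; rewrite inE; lia.
have lo a : in_compl (A :|: X) a -> (0 < a)%N -> (j < a)%N.
  move=> aG a0; rewrite ltnNge; apply/negP => aj.
  have aN : (a < N.+1)%N by lia.
  move: aG; rewrite -[a]/(val (Ordinal aN)) in_compl_ord => /negP; apply.
  by rewrite inE inE /= a0 ltnS aj.
split; first by apply/forall_inP => n /hi /andP[]; rewrite lt0n.
move=> a b aG bG; have [->//|a0] := posnP a; have [->|b0] := posnP b; first by rewrite addn0.
have := lo _ aG a0; have := lo _ bG b0 => bj aj.
apply/forall_inP => n /hi /andP[_ nj]; rewrite neq_ltn; apply/orP; left.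
by apply: leq_trans nj _; lia.
Qed.

Lemma card_gap_sets_ge (R : realFieldType) (z : R) (N g : nat) :
  0 < z -> z + z ^+ 2 = 1 -> (0 < g)%N -> (4 * g <= N)%N ->
  z <= g.+1%:R * #|gap_sets N g|%:R * z ^+ g.
Proof.
move=> z0 zz g0 gN; have := sum_bin_ge g z0 zz.
rewrite mulrC ler_pdivrMr ?exprn_gt0 // => /le_trans; apply.
apply: ler_wpM2r; first by apply: exprn_ge0; exact: ltW.
rewrite -natrM ler_nat -[X in (X * _)%N]card_ord -sum_nat_const.
by apply: leq_sum => j _; apply: card_gap_sets_ge_bin => //; rewrite -ltnS.
Qed.

Section TotalCount.
Variables (R : realType) (N s d g : nat) (z eps D gam : R).
Local Notation T := 'I_N.+1.
Local Notation t := (s * s)%N.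
Local Notation K := (t * t)%N.

Definition atypical : {set {set T}} :=
  [set G in gap_sets N g | ~~ `[< near_typical g eps gam G >]].

(** The reason for [t = s * s]: from [t <= exp (2 * s)] the main term [t ^ k] is at most
    [exp (2 * k * s)], and [k * s <= (N + 1) / s]. *)
Lemma card_small_sets_le k : (0 < s)%N -> (t * k <= N.+1)%N ->
  #|[set Q : {set T} | (#|Q| <= k)%N]|%:R <= expR (3 * (N.+1%:R / s%:R)) :> R.
Proof.
move=> s0 tk; have s0' : 0 < s%:R :> R by rewrite ltr0n.
have s1' : 1 <= s%:R :> R by rewrite ler1n.
have t0' : 0 < t%:R :> R by rewrite ltr0n muln_gt0 s0.
apply: le_trans (card_small_sets _ (y := t%:R^-1) k _ _) _.
- by rewrite invr_gt0.
- by rewrite invf_le1 // ler1n muln_gt0 s0.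
have e1 : t%:R^-1 ^- k <= expR (2 * (N.+1%:R / s%:R)) :> R.
  rewrite -exprVn invrK; apply: le_trans (_ : expR (k%:R * (2%:R * s%:R)) <= _).
    apply: expR_pow_le => //; rewrite natrM -expr2 expRM_natl.
    by apply: lerXn2r; rewrite ?nnegrE ?expR_ge0 // (le_trans _ (expR_ge1Dx _)) // lerDr.
  rewrite ler_expR; have -> : k%:R * (2%:R * s%:R) = 2 * ((t * k)%:R / s%:R) :> R.
    by rewrite !natrM; field; apply: lt0r_neq0.
  by rewrite ler_pM2l // ler_pM2r ?invr_gt0 // ler_nat.
have e2 : (1 + t%:R^-1) ^+ #|{: T}| <= expR (N.+1%:R / s%:R) :> R.
  rewrite card_ord; apply: expR_pow_le; first by apply: addr_ge0 => //; rewrite invr_ge0.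
  apply: le_trans (expR_ge1Dx _) _; rewrite ler_expR lef_pV2 ?posrE // ler_nat.
  by rewrite leq_pmulr.
apply: le_trans (ler_pM _ _ e1 e2) _.
- by rewrite invr_ge0; apply: exprn_ge0; rewrite invr_ge0.
- by apply: exprn_ge0; apply: addr_ge0 => //; rewrite invr_ge0.
by rewrite -expRD ler_expR; lra.
Qed.

(** Union bound over fingerprints: [N + 1] values of [M], and three small sets costing
    [3 * (N + 1) / s] each in the exponent. *)
Lemma card_atypical_le : scales N t d g z eps D gam -> (0 < s)%N -> (K < g)%N ->
  (t * K <= N.+1)%N ->
  #|atypical|%:R * z ^+ g <= N.+1%:R ^+ 2 * expR (9 * (N.+1%:R / s%:R) - d%:R / 4).
Proof.
move=> sc s0 Kg KN; have t0 : (0 < t)%N by rewrite muln_gt0 s0.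
pose k := (N.+1 %/ t)%N.
pose small m := [set Q : {set T} | (#|Q| <= m)%N].
pose Fam (x : T * ({set T} * ({set T} * {set T}))) : {set {set T}} :=
  [set G in atypical | `[< fingerprint t K g x.1 x.2.1 x.2.2.1 x.2.2.2 G >]].
pose I := finset.setX [set: T] (finset.setX (small K) (finset.setX (small k) (small k))).
have cov : atypical \subset \bigcup_(x in I) Fam x.
  apply/subsetP => G Gat; have := Gat; rewrite !inE => /andP[/andP[/asboolP sG /eqP Gg] _].
  have [M [P [Q [V fp]]]] := fingerprint_exists sG Gg (sc_N sc) Kg t0.
  have MN : (M < N.+1)%N by have := fp_M fp; have := sc_N sc; lia.
  apply/bigcupP; exists (Ordinal MN, (P, (Q, V))).
    rewrite !inE /= (fp_K fp) leqnn /= !leq_divRL // ![(_ * t)%N]mulnC.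
    by rewrite (fp_sizeQ fp) (fp_sizeV fp).
  by rewrite inE Gat; apply/asboolP.
have bound x : #|Fam x|%:R * z ^+ g <= N.+1%:R * expR (- (d%:R / 4)).
  apply: (template_bound sc) => G /setIdP[]; rewrite !inE.
  by move=> /andP[/andP[/asboolP sG /eqP Gg] /asboolPn nt] /asboolP fp; split; [exact: sG|exact: Gg|exact: fp|exact: nt].
have cI : #|I|%:R <= N.+1%:R * expR (9 * (N.+1%:R / s%:R)) :> R.
  rewrite !cardsX cardsT card_ord 3!natrM; apply: ler_wpM2l => //.
  have kN : (t * k <= N.+1)%N by rewrite mulnC leq_trunc_div.
  have b1 := card_small_sets_le s0 kN; have b2 := card_small_sets_le s0 KN.
  apply: le_trans (ler_pM _ _ b2 (ler_pM _ _ b1 b1)) _ => //; first by rewrite mulr_ge0.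
  by rewrite -!expRD ler_expR; lra.
have zg0 : 0 <= z ^+ g by apply: exprn_ge0; case: (sc_z sc) => /ltW.
apply: le_trans (_ : (\sum_(x in I) #|Fam x|)%:R * z ^+ g <= _).
  apply: ler_wpM2r => //; rewrite ler_nat.
  exact: leq_trans (subset_leq_card cov) (leq_card_bigcup _ _).
rewrite natr_sum mulr_suml; apply: le_trans (ler_sum _ (fun x _ => bound x)) _.
rewrite sumr_const -[leLHS]mulr_natl.
apply: le_trans (ler_wpM2r _ cI) _; first by apply: mulr_ge0 => //; exact: expR_ge0.
by rewrite expRD expr2 mulrACA.
Qed.

End TotalCount.

(** * Choice of constants and exponential decay *)

Lemma golden_conjugate (R : realType) : let z : R := (Num.sqrt 5 - 1) / 2 in
  [/\ 0 < z, z + z ^+ 2 = 1 & (5 + Num.sqrt 5) / 10 * (1 + z ^+ 2) = 1].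
Proof.
move=> z; have s5 : Num.sqrt (5 : R) * Num.sqrt 5 = 5 by rewrite -expr2 sqr_sqrtr.
have s0 : 2 <= Num.sqrt (5 : R).
  by rewrite leNgt; apply/negP => h; have := sqrtr_ge0 (5 : R); nra.
rewrite {}/z; move: (Num.sqrt 5) s5 s0 => x x5 x0; split.
- by lra.
- by have -> : (x - 1) / 2 + ((x - 1) / 2) ^+ 2 = (x * x - 1) / 4; [field | rewrite x5; lra].
have -> : (5 + x) / 10 * (1 + ((x - 1) / 2) ^+ 2) = ((x * x - 5) * (x + 3) + 40) / 40.
  by field.
by rewrite x5; lra.
Qed.

(** The order of choice is [eta], then [r], then [s], with [d = g %/ r]. As
    [4 * g + 1 <= 10 * r * d], the factor 1440 makes the entropy [9 * (N + 1) / s] at most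
    [d / 16]. *)
Lemma scales_eventually (R : realType) (eps : R) : 0 < eps ->
  exists (s r : nat) (eta : R), [/\ (0 < r)%N, s = (1440 * r)%N &
    forall g z gam, 0 < z -> z + z ^+ 2 = 1 -> gam * (1 + z ^+ 2) = 1 ->
     let t := (s * s)%N in let K := (t * t)%N in
     (r * (K * K + K + 1) <= g)%N -> scales (4 * g) t (g %/ r) g z eps (eta * g%:R) gam].
Proof.
move=> eps0; pose eta : R := Num.min (eps / 8) (1 / 40).
have eta0 : 0 < eta by rewrite lt_min; apply/andP; split; lra.
have [eta1 eta2] : eta <= eps / 8 /\ eta <= 1 / 40 by rewrite /eta !ge_min !lexx orbT.
pose r := Num.bound (1000 / eta ^+ 2).
have r1 : 1000 <= eta ^+ 2 * r%:R.
  have : 1000 / eta ^+ 2 < r%:R by apply: archi_boundP; apply: divr_ge0 => //; exact: exprn_ge0 (ltW eta0).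
  by rewrite ltr_pdivrMr ?exprn_gt0 // mulrC => /ltW.
have r0 : (0 < r)%N.
  by rewrite lt0n; apply/negP => /eqP r0; move: r1; rewrite r0 mulr0; lra.
exists (1440 * r)%N, r, eta; split => // g z gam z0 zz gamE t K gK.
set d := (g %/ r)%N.
have Kd : (K * K + K + 1 <= d)%N by rewrite leq_divRL // mulnC.
have d0 : (0 < d)%N by rewrite (leq_trans _ Kd) // addn1.
have dg : (d * r <= g)%N by exact: leq_trunc_div.
have gd : (g < d.+1 * r)%N by rewrite ltn_ceil.
have g0 : (0 < g)%N by rewrite (leq_trans _ dg) // muln_gt0 d0.
have gd2 : (g <= 2 * (r * d))%N by clear -gd d0; nia.
have dg' : 1000 * d%:R <= eta ^+ 2 * g%:R.
  apply: le_trans (_ : eta ^+ 2 * (d * r)%:R <= _); last first.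
    by apply: ler_wpM2l; rewrite ?ler_nat // exprn_ge0 // ltW.
  by rewrite natrM mulrCA mulrC; apply: ler_wpM2l.
have ge : eta ^+ 2 * g%:R <= eta * g%:R / 40.
  by rewrite expr2 -mulrA; have : eta * (eta * g%:R) <= (1 / 40) * (eta * g%:R); [apply: ler_wpM2r => //; apply: mulr_ge0 => //; exact: ltW | lra].
have e1 : eta * g%:R <= eps / 8 * g%:R by apply: ler_wpM2r.
have e2 : eta * g%:R <= 1 / 40 * g%:R by apply: ler_wpM2r.
have e0 : 0 < eta * g%:R by rewrite mulr_gt0 // ltr0n.
have d0' : 0 <= d%:R :> R by [].
split => //.
- by rewrite /t; clear -r0; nia.
- rewrite /t; apply: leq_trans (_ : (5 * g <= _)%N); first by clear -g0; lia.
  by rewrite /t; clear -gd2 r0; nia.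
- exact: ltW.
- have -> : (eta * g%:R) ^+ 2 = g%:R * (eta ^+ 2 * g%:R) by ring.
  by rewrite -mulrA mulrCA; apply: ler_wpM2l => //; lra.
- by lra.
- by lra.
Qed.

Lemma atypical_fraction (R : realType) (eps : R) : 0 < eps ->
  exists (C q : R) (g0 : nat), [/\ 0 <= q, q < 1 & forall g, (g0 <= g)%N ->
    #|atypical (4 * g) g eps ((5 + Num.sqrt 5) / 10 : R)|%:R
      <= C * q ^+ g * #|gap_sets (4 * g) g|%:R].
Proof.
move=> eps0; have [z0 zz gamE] := golden_conjugate R; set z := _ / 2 in z0 zz gamE.
have [s [r [eta [r0 sE Hsc]]]] := scales_eventually eps0.
pose t := (s * s)%N; pose K := (t * t)%N.
have r0' : 0 < r%:R :> R by rewrite ltr0n.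
(* The exponent is at most [- 3 * d / 16]. Half of it absorbs the polynomial [50 * g ^ 3] through
   [g <= 2 * r * d <= 64 * r * exp (d / 32)]; the other half gives [q ^ g]. *)
exists (50 / z * (64 * r%:R) ^+ 3), (expR (- (3 / (64 * r%:R)))), (r * (K * K + K + 1))%N.
split; first exact: expR_ge0.
  by rewrite -[ltRHS]expR0 ltr_expR oppr_lt0 divr_gt0 // mulr_gt0.
move=> g gK; have sc := Hsc g z _ z0 zz gamE gK; set gam := _ / 10 in sc gamE *.
set d := (g %/ r)%N in sc.
have Kd := sc_K sc; have g0 := sc_g sc; have td := sc_td sc.
have s0 : (0 < s)%N by rewrite sE muln_gt0 r0.
have t0 : (0 < t)%N by rewrite muln_gt0 s0.
have d0 : (0 < d)%N by rewrite (leq_trans _ Kd) // addn1.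
have dg : (d * r <= g)%N by exact: leq_trunc_div.
have gd : (g < d.+1 * r)%N by rewrite ltn_ceil.
have gd2 : (g <= 2 * (r * d))%N by clear -gd d0; nia.
have dg1 : (d <= g)%N by rewrite leq_div.
have KK : (K <= K * K)%N by rewrite leq_pmulr // muln_gt0 t0.
have Kg : (K < g)%N.
  by apply: leq_trans dg1; apply: leq_trans Kd; rewrite -/t -/K -addnA addn1 ltnS leq_addr || (clear; lia).
have tK : (t * K <= (4 * g).+1)%N.
  apply: leq_trans (_ : (K * K <= _)%N); first by rewrite leq_mul2r leq_pmulr ?orbT.
  by apply: leq_trans (_ : (d <= _)%N); move: Kd dg1; rewrite -/t -/K; clear; lia.
have up := card_atypical_le sc s0 Kg tK.
have low := card_gap_sets_ge z0 zz g0 (sc_N sc).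
set A := #|atypical _ _ _ _|%:R in up *; set V := #|gap_sets _ _|%:R in low *.
have A0 : 0 <= A by []. have V0 : 0 <= V by [].
have zg : 0 < z ^+ g by exact: exprn_gt0.
have g1 : 1 <= g%:R :> R by rewrite ler1n.
have gR : g%:R <= 2 * r%:R * d%:R :> R by rewrite -!natrM ler_nat -mulnA.
have N5 : (4 * g).+1%:R <= 5 * g%:R :> R by rewrite -natrM ler_nat; clear -g0; lia.
have ex : 9 * ((4 * g).+1%:R / s%:R) - d%:R / 4 <= - (3 / 16 * d%:R) :> R.
  have : (4 * g).+1%:R / s%:R <= d%:R / 144 :> R.
    rewrite sE natrM ler_pdivrMr ?mulr_gt0 //.
    have -> : d%:R / 144 * (1440%:R * r%:R) = 10 * (r%:R * d%:R) :> R by field.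
    by lra.
  by lra.
have poly : (5 * g%:R) ^+ 2 * (2 * g%:R) <= 50 * (64 * r%:R) ^+ 3 * expR (3 / 32 * d%:R) :> R.
  have -> : (5 * g%:R) ^+ 2 * (2 * g%:R) = 50 * g%:R ^+ 3 :> R by ring.
  rewrite -mulrA; apply: ler_wpM2l => //.
  have -> : 3 / 32 * d%:R = 3%:R * (d%:R / 32) :> R by field.
  rewrite expRM_natl -exprMn; apply: lerXn2r; rewrite ?nnegrE ?mulr_ge0 ?expR_ge0 //.
  apply: le_trans gR _.
  have -> : 2 * r%:R * d%:R = 64 * r%:R * (d%:R / 32) :> R by field.
  apply: ler_wpM2l; first by apply: mulr_ge0.
  by apply: le_trans (expR_ge1Dx _); lra.
have qg : expR (- (3 / 32 * d%:R)) <= expR (- (3 / (64 * r%:R))) ^+ g :> R.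
  rewrite -expRM_natl ler_expR mulrN lerN2.
  have -> : g%:R * (3 / (64 * r%:R)) = 3 / 64 * g%:R / r%:R :> R by field; exact: lt0r_neq0.
  by rewrite ler_pdivrMr //; lra.
have up' : A * z ^+ g <= (5 * g%:R) ^+ 2 * expR (- (3 / 16 * d%:R)).
  apply: le_trans up _; apply: ler_pM; rewrite ?exprn_ge0 ?expR_ge0 ?ler_expR //.
  by apply: lerXn2r; rewrite ?nnegrE //; lra.
have low' : z <= 2 * g%:R * (V * z ^+ g).
  apply: le_trans low _; rewrite -mulrA; apply: ler_wpM2r.
    by apply: mulr_ge0 => //; exact: ltW.
  by rewrite -natr1; lra.
rewrite -(ler_pM2r zg) -(ler_pM2r z0).
apply: le_trans (ler_pM _ _ up' low') _.
- by apply: mulr_ge0 => //; exact: ltW.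
- exact: ltW.
have -> : (5 * g%:R) ^+ 2 * expR (- (3 / 16 * d%:R)) * (2 * g%:R * (V * z ^+ g))
  = ((5 * g%:R) ^+ 2 * (2 * g%:R)) * expR (- (3 / 16 * d%:R)) * (V * z ^+ g) by ring.
have -> : 50 / z * (64 * r%:R) ^+ 3 * expR (- (3 / (64 * r%:R))) ^+ g * V * z ^+ g * z
  = 50 * (64 * r%:R) ^+ 3 * expR (- (3 / (64 * r%:R))) ^+ g * (V * z ^+ g).
  by field; exact: lt0r_neq0.
apply: ler_wpM2r; first by apply: mulr_ge0 => //; exact: ltW.
have c0 : 0 <= 50 * (64 * r%:R) ^+ 3 :> R by apply: mulr_ge0 => //; apply: exprn_ge0; lra.
move: c0 poly; set c := 50 * _ => c0 poly.
apply: le_trans (ler_wpM2r (expR_ge0 _) poly) _.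
rewrite -[leLHS]mulrA -expRD; apply: ler_wpM2l => //.
apply: le_trans qg; rewrite ler_expR; lra.
Qed.

(** * From gap sets to numerical semigroups *)

From mathcomp Require Import classical_sets functions cardinality ereal topology normedtype.
From mathcomp Require Import finmap.
Import numFieldNormedType.Exports.
Local Open Scope classical_set_scope.
Local Open Scope ring_scope.

Lemma card_fset_set_imset (T : finType) (U : choiceType) (f : T -> U) (B : {set T}) :
  injective f -> #|` fset_set [set f x | x in [set` B]]| = #|B|.
Proof.
move=> fI.
have -> : fset_set [set f x | x in [set` B]] = (f @` [fset x in B])%fset.
  apply/fsetP => y; rewrite in_fset_set; last exact/finite_image/finite_finset.
  apply/idP/imfsetP => [/set_mem[x xB <-]|[x xB ->]].
    by exists x => //; rewrite inE.
  by apply/mem_set; exists x => //; move: xB; rewrite inE.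
rewrite -(card_finset (mem B)); apply/eqP/card_in_imfsetP.
by move=> x y _ _; exact: fI.
Qed.

Lemma card_fset_set_ord (N : nat) (A : set nat) (B : {set 'I_N.+1}) :
  (forall n, A n -> (n <= N)%N) -> (forall i : 'I_N.+1, A i <-> i \in B) ->
  #|` fset_set A| = #|B|.
Proof.
move=> AN AB; rewrite -(card_fset_set_imset B (@ord_inj N.+1)).
congr (#|` fset_set _|); apply/seteqP; split => n.
  move=> An; have nN : (n < N.+1)%N by rewrite ltnS AN.
  by exists (Ordinal nN) => //; apply/(AB (Ordinal nN)).
by case=> i /= /AB Ai <-.
Qed.

Definition compl_gaps N (G : {set 'I_N.+1}) : set nat := [set n | in_compl G n].

Section Transfer.
Variables (N g : nat) (G : {set 'I_N.+1}).
Hypothesis (sG : gap_set G) (Gg : #|G| = g).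
Local Notation S := (compl_gaps G).

Lemma compl_gaps_le n : ~ S n -> (n <= N)%N.
Proof. by move=> Sn; rewrite leqNgt; apply/negP => /(@in_compl_big N G). Qed.

Lemma compl_gapsE (i : 'I_N.+1) : S i <-> i \notin G.
Proof. by rewrite -in_compl_ord. Qed.

Lemma genus_compl_gaps : genus S = #|G|.
Proof.
apply: card_fset_set_ord => [n /compl_gaps_le //|i].
by split=> [/compl_gapsE/negP|iG /compl_gapsE]; rewrite ?negbK ?iG.
Qed.

Lemma compl_gaps_semigroup : numerical_semigroup S.
Proof.
case: sG => G0 GD; split => //.
apply: (@sub_finite_set _ _ `I_N.+1); last exact: finite_II.
by move=> n /compl_gaps_le; rewrite -ltnS.
Qed.

Lemma stype_compl_gaps : stype S = #|pfs G|.
Proof.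
apply: card_fset_set_ord => [n [/compl_gaps_le //]|i].
rewrite inE; split => [[Si iS]|/andP[iG /forallP iS]].
  apply/andP; split; first by rewrite -[_ \in _]negbK; apply/negP => /compl_gapsE.
  by apply/forallP => s; apply/implyP => /andP[s0 sG']; apply: iS => //; apply/compl_gapsE.
split; first by move=> /compl_gapsE; rewrite iG.
move=> s Ss s0; have [sN|sN] := leqP s N; last by apply: in_compl_big; rewrite ltn_addl.
have := iS (Ordinal (sN : (s < N.+1)%N)); rewrite /= s0 => /implyP; apply.
by rewrite -in_compl_ord.
Qed.

(** All numbers from [2 * g] on belong to [S], so any [n > N >= 4 * g] splits as [2 * g] plus
    [n - 2 * g] and is no minimal generator. *)
Lemma edim_compl_gaps : (0 < g)%N -> (4 * g <= N)%N -> edim S = #|gens G|.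
Proof.
move=> g0 gN; have big n : (2 * g <= n)%N -> S n.
  move=> gn; apply: contrapT => Sn; have nN := compl_gaps_le Sn.
  have : Ordinal (nN : (n < N.+1)%N) \in G.
    by rewrite -[_ \in _]negbK; apply/negP => /compl_gapsE.
  by move=> /(gap_lt_double sG); rewrite Gg /= ltnNge gn.
apply: card_fset_set_ord => [n [Sn n0 nab]|i].
  rewrite leqNgt; apply/negP => Nn; apply: nab; exists (2 * g)%N, (n - 2 * g)%N.
  split; [exact: big| by rewrite muln_gt0| by apply: big; lia | by lia | by lia].
rewrite inE; split => [[/compl_gapsE iG i0 nab]|/and3P[i0 iG nab]].
  rewrite i0 iG /=; apply/existsPn => a; apply/existsPn => b.
  apply/negP => /and5P[a0 b0 aG bG /eqP ab]; apply: nab; exists a, b.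
  by split => //; apply/compl_gapsE.
split => //; first exact/compl_gapsE.
move=> [a [b [Sa a0 Sb b0 ab]]].
have [aN bN] : (a < N.+1)%N /\ (b < N.+1)%N by have := ltn_ord i; lia.
move/existsPn: nab => /(_ (Ordinal aN)) /existsPn /(_ (Ordinal bN)).
by rewrite /= a0 b0 -!in_compl_ord /= Sa Sb ab eqxx.
Qed.

End Transfer.

Lemma compl_gaps_inj N : injective (@compl_gaps N).
Proof.
move=> G G' e; apply/setP => i; apply/idP/idP => iG; rewrite -[_ \in _]negbK; apply/negP.
  by move=> /compl_gapsE; rewrite -e => /compl_gapsE; rewrite iG.
by move=> /compl_gapsE; rewrite e => /compl_gapsE; rewrite iG.
Qed.

(** Two passes: finiteness gives some bound [N0] on the gaps, [gap_lt_double] over [N0] improves it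
    to [2 * g], and the construction is repeated with [4 * g]. *)
Lemma semigroup_gap_set g (S : set nat) : semigroups_of_genus g S -> (0 < g)%N ->
  exists2 G : {set 'I_(4 * g).+1}, G \in gap_sets (4 * g) g & S = compl_gaps G.
Proof.
move=> [[S0 SD fS] Sg] g0.
have mk N : (forall n, ~ S n -> (n <= N)%N) ->
    exists2 G : {set 'I_N.+1}, [/\ gap_set G & #|G| = g] & S = compl_gaps G.
  move=> SN; pose G := [set i : 'I_N.+1 | ~~ `[< S i >]]%SET.
  have SG n : in_compl G n <-> S n.
    have [nN|Nn] := leqP n N; last first.
      split=> [_|_]; last exact: in_compl_big.
      by apply: contrapT => /SN; rewrite leqNgt Nn.
    rewrite -[n]/(val (Ordinal (nN : (n < N.+1)%N))) in_compl_ord inE negbK /=.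
    by split=> [/asboolP|Sn]; last exact/asboolP.
  have SE : S = compl_gaps G by apply/seteqP; split => n /SG.
  exists G => //; split; last by rewrite -genus_compl_gaps -SE.
  by split=> [|a b /SG Sa /SG Sb]; apply/SG => //; exact: SD.
have [N0 N0P] : exists N0, forall n, ~ S n -> (n <= N0)%N.
  exists (\max_(i <- fset_set (~` S)) i)%N => n Sn.
  by apply: (@leq_bigmax_seq _ _ (fun=> true) id) => //; rewrite in_fset_set // mem_set.
have [G0 [sG0 G0g] SG0] := mk _ N0P.
have [n Sn|G [sG Gg] SG] := mk (4 * g)%N.
  have nN := N0P _ Sn.
  have : Ordinal (nN : (n < N0.+1)%N) \in G0.
    by rewrite -[_ \in _]negbK; apply/negP => /compl_gapsE; rewrite -SG0.
  by move=> /(gap_lt_double sG0); rewrite G0g /=; lia.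
by exists G => //; rewrite inE Gg eqxx andbT; apply/asboolP.
Qed.

Lemma card_semigroups_of_genus g (A : set (set nat)) : (0 < g)%N ->
  #|` fset_set (semigroups_of_genus g `&` A)|
    = #|[set G in gap_sets (4 * g) g | `[< A (compl_gaps G) >]]%SET|.
Proof.
move=> g0; rewrite -(card_fset_set_imset _ (@compl_gaps_inj (4 * g))).
congr (#|` fset_set _|); apply/seteqP; split => [S [Sg AS]|S [G]].
  have [G Gg SE] := semigroup_gap_set Sg g0; exists G => //.
  by rewrite /= inE Gg; apply/asboolP; rewrite -SE.
rewrite /= !inE => /andP[/andP[/asboolP sG /eqP Gg] /asboolP AG] <-; split => //.
by split; [exact: compl_gaps_semigroup | rewrite genus_compl_gaps].
Qed.

(** Squeeze between [1 - C * q ^ g] and 1; both parts of the theorem are instances. *)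
Lemma prob_g_cvg1 (R : realType) (eps : R) (A : nat -> set (set nat)) : 0 < eps ->
  (forall g (G : {set 'I_(4 * g).+1}), (0 < g)%N -> gap_set G -> #|G| = g ->
     near_typical g eps ((5 + Num.sqrt 5) / 10) G -> A g (compl_gaps G)) ->
  prob_g R g (A g) @[g --> \oo] --> (1 : R).
Proof.
move=> eps0 HA; have [C [q [g0 [q0 q1 Hq]]]] := atypical_fraction eps0.
have [z0 zz _] := golden_conjugate R.
have lim1 : (1 - C * q ^+ g) @[g --> \oo] --> (1 : R).
  rewrite -[X in _ --> X]subr0; apply: cvgB; first exact: cvg_cst.
  by rewrite -(mulr0 C); apply: cvgM; [exact: cvg_cst | apply: cvg_expr; rewrite ger0_norm].
apply: (@squeeze_cvgr _ _ _ _ (fun g => 1 - C * q ^+ g) (fun=> 1)); [|exact: lim1|exact: cvg_cst].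
near=> g; have gpos : (0 < g)%N by near: g; exact: nbhs_infty_gt.
have gg0 : (g0 <= g)%N by near: g; exact: nbhs_infty_ge.
rewrite /prob_g card_semigroups_of_genus //.
have -> : semigroups_of_genus g = semigroups_of_genus g `&` [set: set nat] by rewrite setIT.
rewrite card_semigroups_of_genus //.
have -> : [set G in gap_sets (4 * g) g | `[< setT (compl_gaps G) >]]%SET = gap_sets (4 * g) g.
  by apply/finset.setP => G; rewrite inE asboolT ?andbT.
set good := [set _ in _ | _]%SET; set V := gap_sets _ _.
have V0 : 0 < #|V|%:R :> R.
  rewrite lt0r ler0n andbT; apply/eqP => V0.
  by have := card_gap_sets_ge z0 zz gpos (leqnn (4 * g)); rewrite -/V V0 mulr0 mul0r leNgt z0.
have goodV : (#|good| <= #|V|)%N.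
  by apply/subset_leq_card/fintype.subsetP => G; rewrite inE => /andP[].
have Vgood : (#|V| <= #|good| + #|atypical (4 * g) g eps ((5 + Num.sqrt 5) / 10 : R)|)%N.
  apply: leq_trans (leq_card_setU _ _); apply/subset_leq_card/fintype.subsetP => G GV.
  have := GV; rewrite inE finset.in_setU => /andP[/asboolP sG /eqP Gg].
  have [nt|nt] := pselect (near_typical g eps ((5 + Num.sqrt 5) / 10) G).
    by apply/orP; left; apply/setIdP; split => //; apply/asboolP; exact: HA.
  by apply/orP; right; apply/setIdP; split => //; apply/asboolPn.
apply/andP; split; last by rewrite ler_pdivrMr // mul1r ler_nat.
rewrite ler_pdivlMr // mulrBl mul1r lerBlDr.
apply: le_trans (_ : #|good|%:R + #|atypical (4 * g) g eps ((5 + Num.sqrt 5) / 10 : R)|%:R <= _).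
  by rewrite -natrD ler_nat.
by rewrite lerD2l; exact: Hq.
Unshelve. all: by end_near.
Qed.

Theorem theorem1p5 (R : realType) (eps : R) (heps : 0 < eps) :
  (prob_g R g
     [set S | `| (edim S)%:R - (Num.sqrt 5)^-1 * g%:R | < eps * g%:R]
    @[g --> \oo] --> (1 : R))
  /\
  (prob_g R g
     [set S | `| (stype S)%:R - (1 - (5 + Num.sqrt 5) / 10) * g%:R | < eps * g%:R]
    @[g --> \oo] --> (1 : R)).
Proof.
split; apply: (prob_g_cvg1 heps) => g G g0 sG Gg [He Ht] /=.
  rewrite (edim_compl_gaps sG Gg) //.
  (* The density of generators is [2 * gamma - 1], which equals the inverse of the square root of
     5. *)
  suff -> : (Num.sqrt 5)^-1 = 2 * ((5 + Num.sqrt 5) / 10) - 1 :> R by [].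
  have s5 : Num.sqrt (5 : R) ^+ 2 = 5 by rewrite sqr_sqrtr.
  have s0 : Num.sqrt (5 : R) != 0 by rewrite sqrtr_eq0 -ltNge.
  by apply: (mulfI s0); rewrite mulfV //; nra.
by rewrite stype_compl_gaps.
Qed.
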